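(* Let $M\subset\mathbb{R}^6$ be the open set of triples of non-collinear points $(x_i,y_i)$, $i=1,2,3$, of the plane (indices mod $3$), let $$Z_i=(x_{i+1}-x_{i+2})\,\partial_{x_i}+(y_{i+1}-y_{i+2})\,\partial_{y_i},\qquad i=1,2,3,$$ and let $\mathcal{B}=\mathrm{Span}(Z_1,Z_2,Z_3)$, a rank $3$ distribution on $M$. For $A\in\mathbb{R}\setminus\{0\}$ let $M_A\subset M$ be the set of configurations spanning a triangle of signed area $A$. Then: (1) $M$ is foliated by the $5$-dimensional submanifolds $M_A$, and $\mathcal{B}$ is tangent to each $M_A$, so that every curve in $M$ with velocity in $\mathcal{B}$ stays in a single leaf $M_A$. (2) The rank $2$ distribution $\mathcal{D}=\mathrm{Span}(Z_1-Z_2,\,Z_3-Z_1)$ is a ''square root'' of $\mathcal{B}$: $\mathcal{B}=[\mathcal{D},\mathcal{D}]+\mathcal{D}$. (3) $\mathcal{D}$ has growth vector $(2,3,5)$ on each leaf $M_A$.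
   Context: A point of $\mathbb{R}^6$ with coordinates $(x_1,y_1,x_2,y_2,x_3,y_3)$ encodes three points (''ants'') $\vec r_i=(x_i,y_i)$ in the plane; $\mathcal{B}$ is the velocity distribution of the rule ''the velocity $\dot{\vec r}_i$ is parallel to $\vec r_{i+1}-\vec r_{i+2}$'' (Rule B). The signed area is $A=\tfrac12\sum_{i=1}^3(y_ix_{i+1}-x_iy_{i+1})$. $[\mathcal{D},\mathcal{D}]$ denotes all linear combinations, with functional coefficients, of commutators of vector fields belonging to $\mathcal{D}$. With $\mathcal{D}^0=\mathcal{D}$ and $\mathcal{D}^{I+1}=[\mathcal{D}^I,\mathcal{D}^I]+\mathcal{D}^I$, the growth vector is the sequence of ranks of $\mathcal{D}^0,\mathcal{D}^1,\mathcal{D}^2,\dots$ (listed until it stabilizes). *)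

(* Defs.v *)
From HB Require Import structures.
From mathcomp Require Export all_boot all_order all_algebra.
From mathcomp Require Export all_classical all_reals all_analysis.

Set Implicit Arguments.
Unset Strict Implicit.
Unset Printing Implicit Defensive.

Import Order.TTheory GRing.Theory Num.Theory.
Export numFieldNormedType.Exports.
Local Open Scope classical_set_scope.
Local Open Scope ring_scope.

Section Smooth.
Context {R : realType} {V W : normedModType R}.

Fixpoint Ck (k : nat) (U : set V) (f : V -> W) : Prop :=
  match k with
  | 0 => forall p, U p -> {for p, continuous f}
  | k'.+1 => (forall p, U p -> differentiable f p) /\
             (forall v : V, Ck k' U (fun p => 'D_v f p))
  end.

(* Meaningful for U open. *)
Definition smooth (U : set V) (f : V -> W) : Prop := forall k, Ck k U f.

End Smooth.

Section Geometry.
Context {R : realType} {n : nat}.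
Local Notation E := 'rV[R]_n.+1.
Local Notation vfield := (E -> E).

Definition chart (O : set E) (phi : E -> E) : Prop :=
  [/\ open O, smooth O phi, open (phi @` O) &
      exists2 psi : E -> E, smooth (phi @` O) psi &
        forall q, O q -> psi (phi q) = q].

Definition same_transverse (k : nat) (u v : E) : Prop :=
  forall j : 'I_n.+1, (k <= j)%N -> u 0 j = v 0 j.

Definition submanifold (k : nat) (S : set E) : Prop :=
  forall p, S p -> exists O phi, [/\ chart O phi, O p &
    S `&` O = [set q | O q /\ same_transverse k (phi q) 0]].

(* A foliation of M with leaves [L i], [i] in [I]: a partition of M into
   connected k-dimensional submanifolds such that around every point of M there
   is a chart in which the connected components of the traces of the leaves are
   the slices obtained by fixing the coordinates of index at least k. *)
Definition foliated_by (T : Type) (k : nat) (M : set E) (I : set T)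
    (L : T -> set E) : Prop :=
  [/\ partition I L M,
      forall i, I i -> connected (L i) /\ submanifold k (L i) &
      forall p, M p -> exists O phi, [/\ chart O phi, O p, O `<=` M &
        forall i q, I i -> (L i `&` O) q ->
          connected_component (L i `&` O) q =
          [set q' | O q' /\ same_transverse k (phi q') (phi q)]]].

Definition tangent_vector (S : set E) (p v : E) : Prop :=
  exists (e : R) (gamma : R -> E),
    [/\ 0 < e, smooth (ball (0 : R) e) gamma,
        forall t, ball (0 : R) e t -> S (gamma t),
        gamma 0 = p & derive1 gamma 0 = v].

Definition lie_bracket (X Y : vfield) : vfield :=
  fun p => 'D_(X p) Y p - 'D_(Y p) X p.

(* Distributions are given by their modules of sections.  Below, U is an open
   set and S is a submanifold closed in U (possibly S = U).  A vector field on S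
   is represented by its smooth extensions to U: every condition is imposed on S
   only, and each set of vector fields below is stable under changing the
   extension.  Brackets may be computed with arbitrary extensions as long as the
   fields involved are tangent to S along S. *)

Definition combination (U S : set E) (m : nat) (X : 'I_m -> vfield)
    (V : vfield) : Prop :=
  exists2 c : 'I_m -> E -> R, forall i, smooth U (c i) &
    forall p, S p -> V p = \sum_(i < m) c i p *: X i p.

Definition Span (U S : set E) (m : nat) (X : 'I_m -> vfield) : set vfield :=
  [set V | smooth U V /\ combination U S X V].

Definition brackets (U S : set E) (D : set vfield) : set vfield :=
  [set V | smooth U V /\ exists m (X Y : 'I_m -> vfield),
    (forall i, D (X i) /\ D (Y i)) /\
    combination U S (fun i => lie_bracket (X i) (Y i)) V].

Definition sum_distr (U S : set E) (D1 D2 : set vfield) : set vfield :=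
  [set V | smooth U V /\ exists X Y,
    [/\ D1 X, D2 Y & forall p, S p -> V p = X p + Y p]].

Fixpoint derived_flag (U S : set E) (D : set vfield) (I : nat) : set vfield :=
  match I with
  | 0 => D
  | I'.+1 => let DI := derived_flag U S D I' in
             sum_distr U S (brackets U S DI) DI
  end.

Definition fiber_at (D : set vfield) (p : E) : set E := [set X p | X in D].

Definition has_rank (S : set E) (D : set vfield) (k : nat) : Prop :=
  forall p, S p -> exists2 W : 'M[R]_(k, n.+1), row_free W &
    fiber_at D p = [set v : E | (v <= W)%MS].

Definition tangent_to (S : set E) (D : set vfield) : Prop :=
  forall p, S p -> fiber_at D p `<=` tangent_vector S p.

(* The ranks of D^0, D^1, ... are the entries of s, then stay equal to its last
   entry; s increases strictly since the flag stabilizes at the first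
   repetition. *)
Definition has_growth_vector (U S : set E) (D : set vfield) (s : seq nat)
  : Prop :=
  sorted ltn s /\
  forall I, has_rank S (derived_flag U S D I) (nth (last 0%N s) s I).

(* Curves are parametrized by an arbitrary interval of R (open or not, bounded
   or not); the velocity is required at interior times only. *)
Definition integral_curve (J : set R) (M : set E) (D : set vfield)
    (gamma : R -> E) : Prop :=
  [/\ is_interval J, {within J, continuous gamma},
      forall t, J t -> M (gamma t) &
      forall t, J° t -> derivable gamma t 1 /\
                        fiber_at D (gamma t) (derive1 gamma t)].

End Geometry.

Section Ants.
Variable R : realType.
Local Notation E := 'rV[R]_6.

(* Coordinates are (x_1, y_1, x_2, y_2, x_3, y_3); the ants are indexed by
   'I_3, whose ring structure is that of the integers mod 3. *)
Definition ix (i : 'I_3) : 'I_6 := inord (2 * i)%N.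
Definition iy (i : 'I_3) : 'I_6 := inord (2 * i).+1.

Definition xc (p : E) (i : 'I_3) : R := p 0 (ix i).
Definition yc (p : E) (i : 'I_3) : R := p 0 (iy i).

Definition collinear (p : E) : Prop :=
  exists a b c : R, (a, b) <> (0, 0) /\
    forall i, a * xc p i + b * yc p i = c.

Definition Mset : set E := [set p | ~ collinear p].

Definition area (p : E) : R :=
  2^-1 * \sum_(i < 3) (yc p i * xc p (i + 1) - xc p i * yc p (i + 1)).

Definition leaf (A : R) : set E := [set p | Mset p /\ area p = A].

Definition Z (i : 'I_3) : E -> E := fun p =>
  (xc p (i + 1) - xc p (i + 2)) *: delta_mx 0 (ix i) +
  (yc p (i + 1) - yc p (i + 2)) *: delta_mx 0 (iy i).

(* Z 0, Z 1, Z 2 are the fields Z_1, Z_2, Z_3; [sqrtZ] lists Z_1 - Z_2 and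
   Z_3 - Z_1. *)
Definition sqrtZ (j : 'I_2) : E -> E :=
  if val j == 0%N then Z 0 \- Z 1 else Z 2 \- Z 0.

Definition distrB : set (E -> E) := Span Mset Mset Z.

Definition distrD : set (E -> E) := Span Mset Mset sqrtZ.

Definition distrD_on_leaf (A : R) : set (E -> E) := Span Mset (leaf A) sqrtZ.

End Ants.

Arguments Mset : clear implicits.
Arguments leaf : clear implicits.
Arguments distrB : clear implicits.
Arguments distrD : clear implicits.
Arguments distrD_on_leaf : clear implicits.

(* Main.v *)
(** For three points the signed area is bilinear in the abscissae and the ordinates, and
    its differential kills every [Z_i].  If [v] is in the kernel of the differential at [p],
    the line [p + t v] changes the area only by [t^2 area v], so rescaling the abscissae by
    [A / (A + t^2 area v)] gives a curve in the leaf with velocity [v].  Hence the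
    derivative along [v] of a function depends only on its values on the leaf, which makes
    brackets of fields known on a leaf computable.  All fields being linear,
    [[Z_1 - Z_2, Z_3 - Z_1] = -(Z_1 + Z_2 + Z_3)], which gives the square root, and
    [Z_1, Z_2, Z_3, [Z_1, Z_2], [Z_2, Z_3]] span the kernel of the differential of the area.
    Brackets never leave this kernel because the second differential is symmetric.
    As the area is affine in the first point with a nonzero gradient, it completes
    five coordinates into a foliated chart; a leaf is connected since it is parametrized by
    one point, the polar coordinates of one edge, and a shear. *)
From HB Require Import structures.
From mathcomp Require Import ring lra.
Require Import Defs.
Set Implicit Arguments.
Unset Strict Implicit.
Unset Printing Implicit Defensive.
Import Order.TTheory GRing.Theory Num.Theory.
Local Open Scope classical_set_scope.
Local Open Scope ring_scope.

(** * Calculus of C^k maps *)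

Section CkVector.
Context {R : realType} {V W : normedModType R}.
Implicit Types (U : set V) (f g : V -> W).

(** The difference [g - f] vanishes near [p], so the zero map is its differential there, with a
    remainder that is eventually zero. *)
Lemma near_eq_differentiable f g (p : V) :
  (\near p, f p = g p) -> differentiable f p -> differentiable g p.
Proof.
move=> fg df; have fgp := nbhs_singleton fg.
pose z := g \- f.
have -> : g = f + z by apply/funext => x; rewrite /z !fctE/= addrC subrK.
apply: differentiableD => //.
have z0 : \near p, z p = 0 by apply: filterS fg => q; rewrite /z/= => ->; rewrite subrr.
apply/diff_locallyP.
have cont0 : continuous (\0 : {linear V -> W}) by exact: cst_continuous.
have E : z \o shift p = cst (z p) + (\0 : {linear V -> W}) +o_ (0 : V) id.
  apply/eqaddoE; apply/eqaddoP => _ /posnumP[e].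
  move: (z0); rewrite (near_shift (0 : V)) subr0 /=; apply: filterS => h /= zh.
  by rewrite !fctE /= zh (nbhs_singleton z0) !addr0 subrr normr0 mulr_ge0.
by rewrite (diff_unique cont0 E).
Qed.

(** Openness turns equality on [U] into equality near each point, so the directional derivatives
    agree on [U] and the induction goes on. *)
Lemma Ck_ext k U f g : open U -> (forall p, U p -> f p = g p) ->
  Ck k U f -> Ck k U g.
Proof.
move=> oU; elim: k f g => [|k IH] f g fg /=.
  move=> cf p Up; have nU : \near p, f p = g p.
    by near=> q; apply: fg; near: q; exact: open_nbhs_nbhs.
  rewrite /prop_for /continuous_at -(fg _ Up).
  exact: cvg_trans (near_eq_cvg nU) (cf _ Up).
have nU p : U p -> \near p, f p = g p.
  by move=> Up; near=> q; apply: fg; near: q; exact: open_nbhs_nbhs.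
move=> [df Df]; split=> [p Up|v]; first exact: near_eq_differentiable (nU _ Up) (df _ Up).
by apply: IH (Df v) => p Up; exact: near_eq_derive (nU _ Up).
Unshelve. all: by end_near. Qed.

Lemma CkW k U f : Ck k.+1 U f -> Ck k U f.
Proof.
elim: k f => [|k IH] f [df Df]; first by move=> p /df /differentiable_continuous.
by split=> // v; exact: (IH _ (Df v)).
Qed.

Lemma Ck_cst k U (w : W) : Ck k U (fun _ => w).
Proof.
elim: k w => [|k IH] w /=; first by move=> p _; exact: cst_continuous.
split=> [p _|v]; first exact: differentiable_cst.
suff -> : (fun p : V => 'D_v (fun=> w) p) = fun=> 0 by exact: IH.
by apply/funext => p; rewrite derive_cst.
Qed.

Lemma Ck_linear k U (f : {linear V -> W}) : continuous f -> Ck k U f.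
Proof.
move=> cf; case: k => [|k] /=; first by move=> p _; exact: cf.
split=> [p _|v]; first exact: linear_differentiable.
suff -> : (fun p : V => 'D_v f p) = fun=> f v by exact: Ck_cst.
by apply/funext => p; rewrite deriveE ?diff_lin//; exact: linear_differentiable.
Qed.

Lemma CkD k U f g : open U -> Ck k U f -> Ck k U g -> Ck k U (fun p => f p + g p).
Proof.
move=> oU; elim: k f g => [|k IH] f g /=.
  by move=> cf cg p Up; apply: continuousD; [exact: cf|exact: cg].
move=> [df Df] [dg Dg]; split=> [p Up|v].
  by apply: differentiableD; [exact: df|exact: dg].
apply: Ck_ext (IH _ _ (Df v) (Dg v)) => // p Up.
by rewrite deriveD//; apply: diff_derivable; [exact: df|exact: dg].
Qed.

Lemma Ck_sum k U n (f : 'I_n -> V -> W) : open U ->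
  (forall i, Ck k U (f i)) -> Ck k U (fun p => \sum_(i < n) f i p).
Proof.
move=> oU; elim: n f => [|n IH] f Cf.
  by under eq_fun do rewrite big_ord0; exact: Ck_cst.
under eq_fun do rewrite big_ord_recr.
by apply: CkD => //; exact: IH.
Qed.

End CkVector.

Section CkScalar.
Context {R : realType} {V : normedModType R}.
Implicit Types (U : set V) (f g : V -> R).

Lemma CkM k U f g : open U -> Ck k U f -> Ck k U g -> Ck k U (fun p => f p * g p).
Proof.
move=> oU; elim: k f g => [|k IH] f g.
  by move=> cf cg p Up; apply: continuousM; [exact: cf|exact: cg].
(* The product rule brings back [f] and [g] undifferentiated, and the induction hypothesis takes
   them one order lower. *)
move=> Cf Cg; have [Cf' Cg'] := (CkW Cf, CkW Cg).
case: Cf Cg => [df Df] [dg Dg]; split=> [p Up|v].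
  by apply: differentiableM; [exact: df|exact: dg].
apply: Ck_ext (CkD oU (IH _ _ Cf' (Dg v)) (IH _ _ Cg' (Df v))) => // p Up.
by rewrite deriveM//; apply: diff_derivable; [exact: df|exact: dg].
Qed.

Lemma CkN k U f : open U -> Ck k U f -> Ck k U (fun p => - f p).
Proof.
move=> oU Cf; under eq_fun do rewrite -mulN1r.
by apply: CkM => //; exact: Ck_cst.
Qed.

Lemma CkB k U f g : open U -> Ck k U f -> Ck k U g -> Ck k U (fun p => f p - g p).
Proof. by move=> oU Cf Cg; apply: CkD => //; exact: CkN. Qed.

Lemma CkV k U f : open U -> (forall p, U p -> f p != 0) -> Ck k U f ->
  Ck k U (fun p => (f p)^-1).
Proof.
move=> oU f0; elim: k => [|k IH].
  by move=> cf p Up; apply: continuousV; [exact: f0|exact: cf].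
(* The derivative of the inverse is minus its square times that of [f], so the inverse itself is
   needed at order [k]. *)
move=> Cf; have CfV := IH (CkW Cf); case: Cf => [df Df]; split=> [p Up|v].
  by apply: differentiableV; [exact: df|exact: f0].
apply: Ck_ext (CkN oU (CkM oU (CkM oU CfV CfV) (Df v))) => // p Up.
rewrite deriveV ?f0//; last exact/diff_derivable/df.
by rewrite -expr2 exprVn -mulNr.
Qed.

End CkScalar.

Section CkRow.
Context {R : realType} {V : normedModType R} {n : nat}.
Implicit Types (U : set V) (f : V -> 'rV[R]_n.+1).

Lemma derive_rV f (p v : V) j : differentiable f p ->
  ('D_v f p) 0 j = 'D_v (fun q => f q 0 j) p.
Proof. by move=> df; rewrite derive_mx ?mxE//; exact: diff_derivable. Qed.

Lemma differentiable_rV f (p : V) :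
  (forall j, differentiable (fun q => f q 0 j : R) p) -> differentiable f p.
Proof.
move=> df; have -> : f = \sum_(j < n.+1) (fun q => f q 0 j *: delta_mx 0 j).
  apply/funext => q; rewrite {1}(row_sum_delta (f q)).
  by rewrite fct_sumE.
by apply: differentiable_sum => j; exact: differentiableZl.
Qed.

Lemma continuous_rV {T : topologicalType} (f : T -> 'rV[R]_n.+1) (p : T) :
  (forall j, {for p, continuous (fun q => f q 0 j : R)}) -> {for p, continuous f}.
Proof.
move=> cf A /nbhs_ballP[e e0 eA].
have cfe : \forall q \near p, forall j, ball (f p 0 j) e (f q 0 j).
  by apply: filter_forall => j; apply: cf; exact: nbhsx_ballx.
apply: filterS cfe => q fe; apply: eA; split=> // i j; rewrite ord1; exact: fe.
Qed.

Lemma Ck_rV k U f : open U ->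
  (forall j, Ck k U (fun p => f p 0 j)) -> Ck k U f.
Proof.
move=> oU; elim: k f => [|k IH] f Cf /=.
  by move=> p Up; apply: continuous_rV => j; exact: Cf.
have df p : U p -> differentiable f p.
  by move=> Up; apply: differentiable_rV => j; have [+ _] := Cf j; apply.
split=> // v; apply: IH => j; have [_ /(_ v)] := Cf j.
by apply: Ck_ext => // p Up; rewrite derive_rV//; exact: df.
Qed.

Lemma Ck_coord k U f j : open U -> Ck k U f -> Ck k U (fun p => f p 0 j).
Proof.
move=> oU; elim: k f => [|k IH] f.
  move=> cf p Up; exact: (continuous_comp (cf _ Up) (@coord_continuous _ _ _ _ _ _)).
move=> [df Df]; split=> [p Up|v].
  apply: (@differentiable_comp _ _ _ _ f (fun M : 'rV[R]_n.+1 => M 0 j)); first exact: df.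
  exact: differentiable_coord.
by apply: Ck_ext (IH _ (Df v)) => // p Up; rewrite derive_rV//; exact: df.
Qed.

End CkRow.

(** * Linear fields, distributions *)

Section LinearFields.
Context {R : realType} {n : nat} {W : normedModType R}.
Local Notation E := 'rV[R]_n.+1.

Lemma linear_rV_continuous (f : {linear E -> W}) : continuous f.
Proof.
move=> p; apply: differentiable_continuous.
have -> : f = \sum_(j < n.+1) (fun q : E => q 0 j *: f (delta_mx 0 j)) :> (E -> W).
  apply/funext => q; rewrite {1}(row_sum_delta q) linear_sum fct_sumE.
  by apply: eq_bigr => j _; rewrite linearZ.
apply: differentiable_sum => j; apply: differentiableZl.
exact: differentiable_coord.
Qed.

Variable f : E -> W.
Hypothesis lf : linear f.

Let F : {linear E -> W} := HB.pack f (GRing.isLinear.Build _ _ _ _ _ lf).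

Lemma smooth_linear U : smooth U f.
Proof. by move=> k; exact: (@Ck_linear _ _ _ k U F (@linear_rV_continuous F)). Qed.

Lemma differentiable_linear p : differentiable f p.
Proof. exact: (@linear_differentiable _ _ _ F p (@linear_rV_continuous F)). Qed.

Lemma derive_linear p v : 'D_v f p = f v.
Proof.
rewrite deriveE; last exact: differentiable_linear.
by rewrite (@diff_lin _ _ _ F p (@linear_rV_continuous F)).
Qed.

End LinearFields.

Section Smooth.
Context {R : realType} {V : normedModType R} {W : normedModType R}.

Lemma smooth_differentiable U (f : V -> W) p : smooth U f -> U p -> differentiable f p.
Proof. by move=> /(_ 1%N)[+ _]; apply. Qed.

End Smooth.

Section Distributions.
Context {R : realType} {n : nat}.
Local Notation E := 'rV[R]_n.+1.
Local Notation vfield := (E -> E).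

(** The derivative of a linear field along [v] is its value at [v]; the bracket is thus the opposite
    of the commutator of the linear maps. *)
Lemma lie_bracket_linear (f g : vfield) p : linear f -> linear g ->
  lie_bracket f g p = g (f p) - f (g p).
Proof. by move=> lf lg; rewrite /lie_bracket !derive_linear. Qed.

Lemma tangent_vectorS (S S' : set E) p v : S `<=` S' ->
  tangent_vector S p v -> tangent_vector S' p v.
Proof.
by move=> SS' [e [g [e0 sg Sg g0 g1]]]; exists e, g; split=> // t /Sg /SS'.
Qed.

(** By the chain rule both derivatives can be taken along a curve in [S] with velocity [v], where
    the two functions coincide. *)
Lemma derive_eq_tangent (W : normedModType R) (S : set E) (f g : E -> W) p v :
  tangent_vector S p v -> differentiable f p -> differentiable g p ->
  (forall q, S q -> f q = g q) -> 'D_v f p = 'D_v g p.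
Proof.
move=> [e [gm [e0 sg Sg g0 g1]]] df dg fg.
have b0 : ball (0 : R) e 0 by exact: ballxx.
have dgm := smooth_differentiable sg b0.
have chain (h : E -> W) : differentiable h p -> 'D_v h p = 'D_1 (h \o gm) 0.
  move=> dh; have dh' : differentiable h (gm 0) by rewrite g0.
  rewrite deriveE// [RHS]deriveE; last exact: differentiable_comp.
  by rewrite -g1 derive1E'// (diff_comp dgm dh') -g0.
rewrite !chain//; apply: near_eq_derive; near=> t; apply/fg/Sg.
by near: t; exact: nbhsx_ballx.
Unshelve. all: by end_near. Qed.

Lemma smooth_comb (U : set E) m (c : 'I_m -> E -> R) (X : 'I_m -> vfield) :
  open U -> (forall i, smooth U (c i)) -> (forall i, smooth U (X i)) ->
  smooth U (fun p => \sum_(i < m) c i p *: X i p).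
Proof.
move=> oU sc sX k; apply: Ck_rV => // j.
under eq_fun do rewrite summxE; apply: Ck_sum => // i.
under eq_fun do rewrite mxE; apply: CkM => //; first exact: sc.
by apply: Ck_coord => //; exact: sX.
Qed.

Lemma derive_comb (U : set E) m (c : 'I_m -> E -> R) (X : 'I_m -> vfield) p v :
  open U -> U p -> (forall i, smooth U (c i)) -> (forall i, smooth U (X i)) ->
  'D_v (fun q => \sum_(i < m) c i q *: X i q) p =
  \sum_(i < m) ('D_v (c i) p *: X i p + c i p *: 'D_v (X i) p).
Proof.
move=> oU Up sc sX.
have dF := smooth_differentiable (smooth_comb oU sc sX) Up.
have dX i := smooth_differentiable (sX i) Up.
have dXj i j : differentiable (fun q => X i q 0 j) p.
  by have [+ _] := Ck_coord j oU (sX i 1%N); apply.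
have dc i := smooth_differentiable (sc i) Up.
apply/rowP => j; rewrite derive_rV// summxE.
have -> : (fun q => (\sum_(i < m) c i q *: X i q) 0 j) =
    \sum_(i < m) (c i * (fun q => X i q 0 j)).
  apply/funext => q; rewrite summxE fct_sumE; apply: eq_bigr => i _.
  by rewrite mxE.
rewrite derive_sum; last by move=> i; apply/diff_derivable/differentiableM.
apply: eq_bigr => i _; rewrite deriveM; [|exact: diff_derivable|exact: diff_derivable].
rewrite !mxE derive_rV; last exact: dX.
by rewrite addrC; congr (_ + _); exact: mulrC.
Qed.

Lemma fiber_Span (U S : set E) m (X : 'I_m -> vfield) p : open U ->
  (forall i, smooth U (X i)) -> S p ->
  fiber_at (Span U S X) p = [set v : E | (v <= \matrix_(i < m) X i p)%MS].
Proof.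
move=> oU sX Sp; apply/seteqP; split=> v /=.
  move=> [F [_ [c _ ->//]]] <-; apply: summx_sub => i _; apply: scalemx_sub.
  by rewrite -(rowK (fun i => X i p)) row_sub.
(* Constant coefficients already reach every vector of the row space. *)
move=> /submxP[a ->]; exists (fun q => \sum_(i < m) a 0 i *: X i q).
  split; first by apply: smooth_comb => // i k; exact: Ck_cst.
  by exists (fun i _ => a 0 i) => // i k; exact: Ck_cst.
by rewrite mulmx_sum_row; apply: eq_bigr => i _; rewrite rowK.
Qed.

Lemma has_rank_Span (U S : set E) m (X : 'I_m -> vfield) : open U ->
  (forall i, smooth U (X i)) ->
  (forall p, S p -> row_free (\matrix_(i < m) X i p)) ->
  has_rank S (Span U S X) m.
Proof.
move=> oU sX fX p Sp; exists (\matrix_(i < m) X i p); first exact: fX.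
exact: fiber_Span.
Qed.

Lemma sum_distr_sub (U S : set E) (D : set vfield) : D `<=` smooth U ->
  D `<=` sum_distr U S (brackets U S D) D.
Proof.
move=> sD X DX; split; first exact: sD.
exists (fun=> 0), X; split=> [|//|p _]; last by rewrite add0r.
split; first by move=> k; exact: Ck_cst.
(* The zero field is the empty combination of brackets. *)
exists 0%N, (fun=> X), (fun=> X); split; first by case.
by exists (fun _ _ => 0) => [i k|p _]; [exact: Ck_cst|rewrite big_ord0].
Qed.

Lemma derived_flag_smooth (U S : set E) (D : set vfield) I : D `<=` smooth U ->
  derived_flag U S D I `<=` smooth U.
Proof. by case: I => [//|I] sD X []. Qed.

End Distributions.

(** * Coordinates *)

Section Coordinates.
Context {R : realType}.
Local Notation E := 'rV[R]_6.
Implicit Types (p q u v : E).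

Definition ants (x0 y0 x1 y1 x2 y2 : R) : E :=
  \row_(j < 6) [:: x0; y0; x1; y1; x2; y2]`_j.

Lemma ord3P (P : 'I_3 -> Prop) : P 0 -> P 1 -> P 2 -> forall i, P i.
Proof.
move=> P0 P1 P2 [[|[|[|//]]] lt3].
- by rewrite (_ : Ordinal lt3 = 0)//; exact/val_inj.
- by rewrite (_ : Ordinal lt3 = 1)//; exact/val_inj.
- by rewrite (_ : Ordinal lt3 = 2)//; exact/val_inj.
Qed.

Lemma addI3E : ((0 + 1 = 1 :> 'I_3)%R * (1 + 1 = 2 :> 'I_3)%R * (2 + 1 = 0 :> 'I_3)%R *
  (0 + 2 = 2 :> 'I_3)%R * (1 + 2 = 0 :> 'I_3)%R * (2 + 2 = 1 :> 'I_3)%R)%type.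
Proof. by do !split; exact/val_inj. Qed.

Lemma eqI3E : (((0 == 1 :> 'I_3)%R = false) * ((0 == 2 :> 'I_3)%R = false) *
  ((1 == 0 :> 'I_3)%R = false) * ((1 == 2 :> 'I_3)%R = false) *
  ((2 == 0 :> 'I_3)%R = false) * ((2 == 1 :> 'I_3)%R = false))%type.
Proof. by do !split. Qed.

Lemma sumI3 (V : nmodType) (F : 'I_3 -> V) : \sum_(i < 3) F i = F 0 + F 1 + F 2.
Proof.
rewrite !big_ord_recl big_ord0 addr0 addrA.
by congr (F _ + F _ + F _); exact/val_inj.
Qed.

Lemma xc_ants x0 y0 x1 y1 x2 y2 : let p := ants x0 y0 x1 y1 x2 y2 in
  ((xc p 0 = x0)%R * (xc p 1 = x1)%R * (xc p 2 = x2)%R)%type.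
Proof. by do !split; rewrite /xc /ix mxE inordK. Qed.

Lemma yc_ants x0 y0 x1 y1 x2 y2 : let p := ants x0 y0 x1 y1 x2 y2 in
  ((yc p 0 = y0)%R * (yc p 1 = y1)%R * (yc p 2 = y2)%R)%type.
Proof. by do !split; rewrite /yc /iy mxE inordK. Qed.

Lemma antsK p : ants (xc p 0) (yc p 0) (xc p 1) (yc p 1) (xc p 2) (yc p 2) = p.
Proof.
apply/rowP => -[j ltj]; rewrite mxE /xc /yc /ix /iy /=.
by case: j ltj => [|[|[|[|[|[|//]]]]]] ltj /=; congr (p 0 _);
  apply/val_inj; rewrite /= inordK.
Qed.

Lemma eq_xcyc p q : (forall i, xc p i = xc q i) -> (forall i, yc p i = yc q i) ->
  p = q.
Proof. by move=> xx yy; rewrite -[p]antsK -[q]antsK !xx !yy. Qed.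

Lemma xcD u v i : xc (u + v) i = xc u i + xc v i. Proof. by rewrite /xc mxE. Qed.
Lemma ycD u v i : yc (u + v) i = yc u i + yc v i. Proof. by rewrite /yc mxE. Qed.
Lemma xcN u i : xc (- u) i = - xc u i. Proof. by rewrite /xc mxE. Qed.
Lemma ycN u i : yc (- u) i = - yc u i. Proof. by rewrite /yc mxE. Qed.
Lemma xcZ (a : R) u i : xc (a *: u) i = a * xc u i. Proof. by rewrite /xc mxE. Qed.
Lemma ycZ (a : R) u i : yc (a *: u) i = a * yc u i. Proof. by rewrite /yc mxE. Qed.
Lemma xc0 i : xc (0 : E) i = 0. Proof. by rewrite /xc mxE. Qed.
Lemma yc0 i : yc (0 : E) i = 0. Proof. by rewrite /yc mxE. Qed.
Lemma xc_sum m (F : 'I_m -> E) i : xc (\sum_(j < m) F j) i = \sum_(j < m) xc (F j) i.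
Proof. by rewrite /xc summxE. Qed.
Lemma yc_sum m (F : 'I_m -> E) i : yc (\sum_(j < m) F j) i = \sum_(j < m) yc (F j) i.
Proof. by rewrite /yc summxE. Qed.
Definition coordE := (xcD, ycD, xcN, ycN, xcZ, ycZ, xc0, yc0).

Lemma ix_inj i j : (ix i == ix j) = (i == j).
Proof.
by apply/eqP/eqP => [|->//]; move: i j; apply: ord3P; apply: ord3P => // /(congr1 val);
  rewrite /ix /= !inordK.
Qed.
Lemma iy_inj i j : (iy i == iy j) = (i == j).
Proof.
by apply/eqP/eqP => [|->//]; move: i j; apply: ord3P; apply: ord3P => // /(congr1 val);
  rewrite /iy /= !inordK.
Qed.
Lemma ixy i j : (ix i == iy j) = false.
Proof.
by apply/eqP; move: i j; apply: ord3P; apply: ord3P => // /(congr1 val);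
  rewrite /ix /iy /= !inordK.
Qed.

Lemma xc_Z i p j : xc (Z i p) j = (j == i)%:R * (xc p (j + 1) - xc p (j + 2)).
Proof.
rewrite /xc /Z !mxE /= ixy ix_inj mulr0 addr0 mulrC.
by have [->|] := eqVneq j i; rewrite ?mul0r.
Qed.
Lemma yc_Z i p j : yc (Z i p) j = (j == i)%:R * (yc p (j + 1) - yc p (j + 2)).
Proof.
rewrite /yc /Z !mxE /= iy_inj eq_sym ixy mulr0 add0r mulrC.
by have [->|] := eqVneq j i; rewrite ?mul0r.
Qed.

Lemma linear_Z i : linear (@Z R i).
Proof.
move=> a u v; apply: eq_xcyc => j; rewrite !(coordE, xc_Z, yc_Z); ring.
Qed.

Lemma linear_sqrtZ j : linear (@sqrtZ R j).
Proof.
move=> a u v; rewrite /sqrtZ; case: ifP => _ /=; rewrite !linear_Z;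
  apply: eq_xcyc => i; rewrite !(coordE, xc_Z, yc_Z); ring.
Qed.

Lemma areaE p : area p = 2^-1 *
  (yc p 0 * xc p 1 - xc p 0 * yc p 1 + (yc p 1 * xc p 2 - xc p 1 * yc p 2) +
   (yc p 2 * xc p 0 - xc p 2 * yc p 0)).
Proof. by rewrite /area sumI3 !addI3E. Qed.

Lemma MsetE p : Mset R p <-> area p != 0.
Proof.
split=> [nc|a0 [a [b [c [ab0 H]]]]].
  apply/eqP => a0; apply: nc.
  (* [(a, b)] is normal to the line through ants [1] and [2]; if these coincide, the line through
     ants [0] and [1] is used, and a vertical line if all three coincide. *)
  pose a := yc p 1 - yc p 2; pose b := xc p 2 - xc p 1.
  have [ab|ab] := pselect ((a, b) = (0, 0)).
    case: ab => /eqP; rewrite subr_eq0 => /eqP ya /eqP; rewrite subr_eq0 => /eqP xa.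
    pose a' := yc p 0 - yc p 1; pose b' := xc p 1 - xc p 0.
    have [ab'|ab'] := pselect ((a', b') = (0, 0)).
      case: ab' => /eqP; rewrite subr_eq0 => /eqP yb /eqP; rewrite subr_eq0 => /eqP xb.
      exists 1, 0, (xc p 0); split; first by case=> /eqP; rewrite oner_eq0.
      by apply: ord3P; rewrite mul1r mul0r addr0//; rewrite ?xa ?xb.
    exists a', b', (a' * xc p 0 + b' * yc p 0); split=> //.
    apply: ord3P => //; rewrite /a' /b' -?ya ?xa; ring.
  exists a, b, (a * xc p 1 + b * yc p 1); split=> //.
  move: a0; rewrite areaE => a0.
  apply: ord3P => //; rewrite /a /b; last by ring.
  by apply/eqP; rewrite -subr_eq0; apply/eqP; move: a0; lra.
move: (H 0) (H 1) (H 2) => H0 H1 H2; move: a0; rewrite areaE => /eqP; apply.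
apply/eqP; rewrite mulf_eq0 invr_eq0 pnatr_eq0 /=; apply/eqP.
(* Twice the area is killed by both [a] and [b]: substituting the equation of the line makes each
   product vanish. *)
have Ea : a * (yc p 0 * xc p 1 - xc p 0 * yc p 1 + (yc p 1 * xc p 2 - xc p 1 * yc p 2) +
   (yc p 2 * xc p 0 - xc p 2 * yc p 0)) = 0.
  transitivity ((a * xc p 1) * (yc p 0 - yc p 2) + (a * xc p 0) * (yc p 2 - yc p 1)
    + (a * xc p 2) * (yc p 1 - yc p 0)); first by ring.
  have -> : a * xc p 1 = c - b * yc p 1 by rewrite -H1; ring.
  have -> : a * xc p 0 = c - b * yc p 0 by rewrite -H0; ring.
  have -> : a * xc p 2 = c - b * yc p 2 by rewrite -H2; ring.
  ring.
have Eb : b * (yc p 0 * xc p 1 - xc p 0 * yc p 1 + (yc p 1 * xc p 2 - xc p 1 * yc p 2) +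
   (yc p 2 * xc p 0 - xc p 2 * yc p 0)) = 0.
  transitivity ((b * yc p 1) * (xc p 2 - xc p 0) + (b * yc p 0) * (xc p 1 - xc p 2)
    + (b * yc p 2) * (xc p 0 - xc p 1)); first by ring.
  have -> : b * yc p 1 = c - a * xc p 1 by rewrite -H1; ring.
  have -> : b * yc p 0 = c - a * xc p 0 by rewrite -H0; ring.
  have -> : b * yc p 2 = c - a * xc p 2 by rewrite -H2; ring.
  ring.
move/eqP: Ea; rewrite mulf_eq0 => /orP[/eqP az|/eqP//].
move/eqP: Eb; rewrite mulf_eq0 => /orP[/eqP bz|/eqP//].
by case: ab0; rewrite az bz.
Qed.

Lemma leafE (A : R) p : A != 0 -> leaf R A p <-> area p = A.
Proof. by move=> A0; split=> [[]//|pA]; split=> //; apply/MsetE; rewrite pA. Qed.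

Section CoordSmooth.
Context {V : normedModType R}.
Implicit Types (U : set V).

Lemma Ck_xc k U (F : V -> E) i : open U -> Ck k U F -> Ck k U (fun t => xc (F t) i).
Proof. exact: Ck_coord. Qed.
Lemma Ck_yc k U (F : V -> E) i : open U -> Ck k U F -> Ck k U (fun t => yc (F t) i).
Proof. exact: Ck_coord. Qed.

Lemma Ck_ants k U (x0 y0 x1 y1 x2 y2 : V -> R) : open U ->
  Ck k U x0 -> Ck k U y0 -> Ck k U x1 -> Ck k U y1 -> Ck k U x2 -> Ck k U y2 ->
  Ck k U (fun t => ants (x0 t) (y0 t) (x1 t) (y1 t) (x2 t) (y2 t)).
Proof.
move=> oU *; apply: Ck_rV => // -[j ltj]; under eq_fun do rewrite mxE /=.
by case: j ltj => [|[|[|[|[|[|//]]]]]] ltj.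
Qed.

Lemma Ck_area k U (F : V -> E) : open U -> Ck k U F -> Ck k U (fun t => area (F t)).
Proof.
move=> oU CF; under eq_fun do rewrite areaE.
by apply: CkM => //; [exact: Ck_cst|];
  repeat (apply: CkB || apply: CkD || apply: CkM || apply: Ck_xc || apply: Ck_yc) => //.
Qed.
End CoordSmooth.

Lemma Ck_id k (V : normedModType R) (U : set V) : Ck k U (fun p : V => p).
Proof. by apply: (@Ck_linear _ _ _ k U (idfun : {linear V -> V})) => p; exact: cvg_id. Qed.

Lemma smooth_area U : open U -> smooth U (@area R).
Proof. by move=> oU k; apply: Ck_area => //; exact: Ck_id. Qed.

Lemma area_continuous : continuous (@area R).
Proof. by move=> p; exact: (smooth_area openT 0%N). Qed.

Lemma open_Mset : open (Mset R).
Proof.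
rewrite (_ : Mset R = @area R @^-1` [set x | x != 0]); last first.
  by apply/seteqP; split=> p /MsetE.
by apply: open_comp; [move=> p _; exact: area_continuous|exact: open_neq].
Qed.

(** The polar form of the quadratic form [area], hence the differential of the area at [p] applied
    to [v]. *)
Definition darea p v := 2^-1 *
  (yc v 0 * xc p 1 - xc p 0 * yc v 1 + (yc v 1 * xc p 2 - xc p 1 * yc v 2) +
   (yc v 2 * xc p 0 - xc p 2 * yc v 0) +
   (yc p 0 * xc v 1 - xc v 0 * yc p 1 + (yc p 1 * xc v 2 - xc v 1 * yc p 2) +
   (yc p 2 * xc v 0 - xc v 2 * yc p 0))).

Lemma areaD_scale p v (t : R) : area (p + t *: v) = area p + t * darea p v + t ^+ 2 * area v.
Proof. by rewrite !areaE /darea !coordE; ring. Qed.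

Lemma dareaC p v : darea p v = darea v p.
Proof. by rewrite /darea; ring. Qed.

Lemma linear_darea p : linear (darea p).
Proof. by move=> a u v; rewrite /darea !coordE /GRing.scale/=; ring. Qed.

(** Ant [i] moves parallel to the opposite side, which keeps both the base and the height. *)
Lemma darea_Z p i : darea p (Z i p) = 0.
Proof.
by move: i; apply: ord3P; rewrite /darea !(xc_Z, yc_Z) ?addI3E ?eqxx ?eqI3E; ring.
Qed.

End Coordinates.

(** * Tangent vectors of the leaves *)

Section Tangent.
Context {R : realType}.
Local Notation E := 'rV[R]_6.
Implicit Types (p q u v : E).

Lemma derive_area p v : 'D_v (@area R) p = darea p v.
Proof.
rewrite /derive; apply: cvg_lim => //.
have -> : (fun h : R => h^-1 *: (((@area R \o shift p) (h *: v)) - area p)) =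
    (fun h => h^-1 * h * (darea p v + h * area v)).
  by apply/funext => h; rewrite /= [_ + p]addrC areaD_scale /GRing.scale/=; ring.
have cv : (fun h : R => darea p v + h * area v) h @[h --> 0^'] --> darea p v.
  have cf : {for (0 : R), continuous (fun h : R => darea p v + h * area v)}.
    by apply: cvgD; [exact: cvg_cst|apply: cvgM; [exact: cvg_id|exact: cvg_cst]].
  by have /continuous_withinNx := cf; rewrite mul0r addr0.
apply: cvg_trans cv; apply: near_eq_cvg; near=> h.
by rewrite mulVf ?mul1r//; near: h; exact: nbhs_dnbhs_neq.
Unshelve. all: by end_near. Qed.

Lemma is_derive_affine (a b : R) : is_derive (0 : R) 1 (fun t : R => a + t * b) b.
Proof.
have := @is_deriveD _ _ _ _ _ _ _ _ _ (is_derive_cst a (0 : R) 1)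
  (is_deriveM (is_derive_id (0 : R) 1) (is_derive_cst b (0 : R) 1)).
rewrite scaler0 !add0r /GRing.scale/= mulr1; exact.
Qed.

(** The correcting factor [A / (A + t^2 Q)] has value 1 and derivative 0 at [t = 0], so it does not
    alter the velocity. *)
Lemma is_derive_ratio (A Q a b : R) : A != 0 ->
  is_derive (0 : R) 1 (fun t : R => A * (A + t * t * Q)^-1 * (a + t * b)) b.
Proof.
move=> A0.
have dQ : is_derive (0 : R) 1 (fun t : R => A + t * t * Q) 0.
  have := @is_deriveD _ _ _ _ _ _ _ _ _ (is_derive_cst A (0 : R) 1)
    (is_deriveM (is_deriveM (is_derive_id (0 : R) 1) (is_derive_id (0 : R) 1)) (is_derive_cst Q (0 : R) 1)).
  by rewrite scaler0 scale0r addr0 add0r scaler0 addr0; apply.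
have dV : is_derive (0 : R) 1 (fun t : R => (A + t * t * Q)^-1) 0.
  have f0 : A + 0 * 0 * Q != 0 by rewrite !mul0r addr0.
  apply: DeriveDef; first by apply: derivableV => //; exact: ex_derive.
  by rewrite deriveV// derive_val scaler0.
have := is_deriveM (is_deriveM (is_derive_cst A (0 : R) 1) dV) (is_derive_affine a b).
rewrite !scaler0 !addr0 /GRing.scale/= !fctE !mul0r addr0 mulfV// mul1r mulr0 addr0.
exact.
Qed.

(* The area is bilinear in the abscissae and the ordinates: rescaling the abscissae of
   [p + t v] corrects its area without changing the velocity at [0]. *)
Lemma tangent_leaf (A : R) p v : A != 0 -> leaf R A p -> darea p v = 0 ->
  tangent_vector (leaf R A) p v.
Proof.
move=> A0 /leafE-/(_ A0) pA dv.
pose h (t : R) := A + t * t * area v.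
pose s (t : R) := A * (h t)^-1.
pose gm (t : R) := ants (s t * (xc p 0 + t * xc v 0)) (yc p 0 + t * yc v 0)
  (s t * (xc p 1 + t * xc v 1)) (yc p 1 + t * yc v 1)
  (s t * (xc p 2 + t * xc v 2)) (yc p 2 + t * yc v 2).
have Ch k (U : set R) : open U -> Ck k U h.
  move=> oU; apply: CkD => //; first exact: Ck_cst.
  apply: CkM => //; last exact: Ck_cst.
  by apply: CkM => //; exact: Ck_id.
have [e e0 he] : exists2 e : R, 0 < e & forall t, ball (0 : R) e t -> h t != 0.
  have h0 : h 0 != 0 by rewrite /h !mul0r addr0.
  have ch : {for (0 : R), continuous h} by exact: (Ch 0%N setT openT).
  have /nbhs_ballP[e e0 eh] : nbhs (0 : R) (h @^-1` [set x | x != 0]).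
    by apply: ch; apply: open_nbhs_nbhs; split=> //; exact: open_neq.
  by exists e.
have sg : smooth (ball (0 : R) e) gm.
  move=> k; have oB : open (ball (0 : R) e) by exact: ball_open.
  have CA (a b : R) : Ck k (ball (0 : R) e) (fun t : R => a + t * b).
    by apply: CkD => //; [exact: Ck_cst|apply: CkM => //; [exact: Ck_id|exact: Ck_cst]].
  have Cs (a b : R) : Ck k (ball (0 : R) e) (fun t : R => s t * (a + t * b)).
    apply: CkM => //; apply: CkM => //; first exact: Ck_cst.
    by apply: CkV => //; exact: Ch.
  exact: Ck_ants.
have b0 : ball (0 : R) e 0 by exact: ballxx.
exists e, gm; split=> // [t /he ht||].
- apply/leafE => //; rewrite areaE /gm !xc_ants !yc_ants.
  transitivity (s t * area (p + t *: v)); first by rewrite areaE !coordE; ring.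
  by rewrite areaD_scale dv mulr0 addr0 pA expr2 /s divfK.
- by rewrite /gm /s /h !mul0r !addr0 mulfV// !mul1r antsK.
- rewrite derive1E; apply/rowP => j; rewrite derive_rV; last exact: smooth_differentiable sg b0.
  have dx i : 'D_1 (fun t => s t * (xc p i + t * xc v i)) 0 = xc v i.
    by have [_] := is_derive_ratio (area v) (xc p i) (xc v i) A0.
  have dy i : 'D_1 (fun t : R => yc p i + t * yc v i) 0 = yc v i.
    by have [_] := is_derive_affine (yc p i) (yc v i).
  rewrite -[v in RHS]antsK; under eq_fun do rewrite mxE; rewrite mxE.
  by case: j => [[|[|[|[|[|[|//]]]]]] ltj] /=; rewrite ?dx ?dy.
Qed.

Lemma tangent_Mset p v : Mset R p -> darea p v = 0 -> tangent_vector (Mset R) p v.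
Proof.
move=> Mp dv; have A0 : area p != 0 by apply/MsetE.
by apply: (@tangent_vectorS _ _ (leaf R (area p))); [move=> q []|exact: tangent_leaf].
Qed.

(** This is the squared length of the side opposite to ant [i]; were it zero, two ants would
    coincide and the area would vanish. *)
Lemma Z_neq0 p i : Mset R p ->
  (xc p (i + 1) - xc p (i + 2)) ^+ 2 + (yc p (i + 1) - yc p (i + 2)) ^+ 2 != 0.
Proof.
move=> /MsetE/eqP; apply: contra_notN; rewrite paddr_eq0 ?sqr_ge0//.
rewrite !sqrf_eq0 !subr_eq0 => /andP[/eqP + /eqP]; rewrite areaE.
by move: i; apply: ord3P; rewrite !addI3E => -> ->; ring.
Qed.

Lemma xc_comb (c : 'I_3 -> R) p i :
  xc (\sum_(j < 3) c j *: Z j p) i = c i * (xc p (i + 1) - xc p (i + 2)).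
Proof.
rewrite xc_sum; under eq_bigr do rewrite xcZ xc_Z.
rewrite (bigD1 i)//= eqxx mul1r big1 ?addr0// => j /negPf ji.
by rewrite eq_sym ji mul0r mulr0.
Qed.
Lemma yc_comb (c : 'I_3 -> R) p i :
  yc (\sum_(j < 3) c j *: Z j p) i = c i * (yc p (i + 1) - yc p (i + 2)).
Proof.
rewrite yc_sum; under eq_bigr do rewrite ycZ yc_Z.
rewrite (bigD1 i)//= eqxx mul1r big1 ?addr0// => j /negPf ji.
by rewrite eq_sym ji mul0r mulr0.
Qed.

Lemma Z_comb_inj (c : 'I_3 -> R) p : Mset R p ->
  \sum_(j < 3) c j *: Z j p = 0 -> forall i, c i = 0.
Proof.
move=> Mp c0 i.
have := congr1 (fun u => xc u i) c0; have := congr1 (fun u => yc u i) c0.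
rewrite xc_comb yc_comb xc0 yc0 => yi xi; have := Z_neq0 i Mp.
(* Only [Z i] moves ant [i], so pairing the displacement of that ant with the opposite side isolates
   [c i]. *)
have : c i * ((xc p (i + 1) - xc p (i + 2)) ^+ 2 + (yc p (i + 1) - yc p (i + 2)) ^+ 2) = 0.
  by rewrite mulrDr !expr2 !mulrA xi yi !mul0r addr0.
by move=> /eqP; rewrite mulf_eq0 => /orP[/eqP//|->].
Qed.

Lemma row_free_rows m (X : 'I_m -> E) :
  (forall c : 'I_m -> R, \sum_(i < m) c i *: X i = 0 -> forall i, c i = 0) ->
  row_free (\matrix_(i < m) X i).
Proof.
move=> Xfree; apply: inj_row_free => u; rewrite mulmx_sum_row => u0.
apply/rowP => i; rewrite mxE; apply: (Xfree (fun i => u 0 i)).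
by rewrite -[RHS]u0; apply: eq_bigr => j _; rewrite rowK.
Qed.

Lemma sumI2 (V : nmodType) (F : 'I_2 -> V) : \sum_(i < 2) F i = F 0 + F 1.
Proof.
by rewrite !big_ord_recl big_ord0 addr0; congr (F _ + F _); exact/val_inj.
Qed.

Lemma sqrtZ0 : sqrtZ 0 = @Z R 0 \- Z 1. Proof. by []. Qed.
Lemma sqrtZ1 : sqrtZ 1 = @Z R 2 \- Z 0. Proof. by []. Qed.

Lemma sqrtZ_comb (c : 'I_2 -> R) p : \sum_(j < 2) c j *: sqrtZ j p =
  (c 0 - c 1) *: Z 0 p + (- c 0) *: Z 1 p + c 1 *: Z 2 p.
Proof.
rewrite sumI2 sqrtZ0 sqrtZ1 /=.
by apply: eq_xcyc => i; rewrite !coordE; ring.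
Qed.

Lemma row_free_Z p : Mset R p -> row_free (\matrix_(i < 3) Z i p).
Proof. by move=> Mp; apply: row_free_rows => c; exact: Z_comb_inj. Qed.

Lemma row_free_sqrtZ p : Mset R p -> row_free (\matrix_(i < 2) sqrtZ i p).
Proof.
move=> Mp; apply: row_free_rows => c; rewrite sqrtZ_comb => c0.
(* The coefficients of the combination on the [Z i], which are already known to be independent. *)
pose d (i : 'I_3) := if i == 0 then c 0 - c 1 else if i == 1 then - c 0 else c 1.
have d0 : forall i, d i = 0 by apply: (Z_comb_inj Mp); rewrite sumI3.
have c00 : c 0 = 0 by apply/eqP; rewrite -oppr_eq0; apply/eqP; exact: (d0 1).
move=> [[|[|//]] lti].
  by rewrite -c00; congr c; exact/val_inj.
by rewrite -(d0 2) /d/=; congr c; exact/val_inj.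
Qed.

Lemma has_rank_Z S : S `<=` Mset R -> has_rank S (Span (Mset R) S (@Z R)) 3.
Proof.
move=> SM; apply: has_rank_Span => [|i|p /SM]; [exact: open_Mset| |exact: row_free_Z].
by apply: smooth_linear; exact: linear_Z.
Qed.

Lemma has_rank_sqrtZ S : S `<=` Mset R -> has_rank S (Span (Mset R) S (@sqrtZ R)) 2.
Proof.
move=> SM; apply: has_rank_Span => [|i|p /SM]; [exact: open_Mset| |exact: row_free_sqrtZ].
by apply: smooth_linear; exact: linear_sqrtZ.
Qed.
End Tangent.

(** * The derived flag *)

HB.instance Definition _ (R : realType) (i : 'I_3) :=
  GRing.isLinear.Build R 'rV[R]_6 'rV[R]_6 _ (@Z R i) (linear_Z i).
HB.instance Definition _ (R : realType) (j : 'I_2) :=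
  GRing.isLinear.Build R 'rV[R]_6 'rV[R]_6 _ (@sqrtZ R j) (linear_sqrtZ j).
HB.instance Definition _ (R : realType) (p : 'rV[R]_6) :=
  GRing.isLinear.Build R 'rV[R]_6 R _ (@darea R p) (linear_darea p).

Section Flag.
Context {R : realType}.
Local Notation E := 'rV[R]_6.
Local Notation M := (Mset R).
Implicit Types (p q u v : E).

Lemma smooth_Z U i : smooth U (@Z R i).
Proof. by apply: smooth_linear; exact: linear_Z. Qed.

Lemma smooth_sqrtZ U i : smooth U (@sqrtZ R i).
Proof. by apply: smooth_linear; exact: linear_sqrtZ. Qed.

Lemma derive_area_comp (V : normedModType R) (F : V -> E) x w :
  differentiable F x -> 'D_w (fun y => area (F y)) x = darea (F x) ('D_w F x).
Proof.
move=> dF; have dA : differentiable (@area R) (F x).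
  exact: smooth_differentiable (smooth_area openT) _.
rewrite deriveE; last exact: differentiable_comp.
by rewrite (diff_comp dF dA)/= -!deriveE// derive_area.
Qed.

(** Reduces derivatives of [darea q (Y q)] to those of [area] along differentiable maps. *)
Lemma darea_polar p v : darea p v = area (p + v) - area p - area v.
Proof. by have := areaD_scale p v 1; rewrite scale1r expr1n !mul1r => ->; ring. Qed.

(** The product rule for a bilinear form; the term [darea v (Y p)] is the second differential of the
    area, whose symmetry makes it cancel in brackets. *)
Lemma derive_darea (Y : E -> E) p v : differentiable Y p ->
  'D_v (fun q => darea q (Y q)) p = darea p ('D_v Y p) + darea v (Y p).
Proof.
move=> dY; under eq_fun do rewrite darea_polar.
have dI : differentiable (fun q : E => q) p by [].
have dD : differentiable (fun q => q + Y q) p by exact: differentiableD.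
have dA (F : E -> E) : differentiable F p -> derivable (fun q => area (F q)) p v.
  move=> dF; apply: diff_derivable; apply: differentiable_comp => //.
  exact: smooth_differentiable (smooth_area openT) _.
rewrite deriveB; [|apply: derivableB|]; try exact: dA.
rewrite deriveB; try exact: dA.
rewrite !derive_area_comp// deriveD; try exact: diff_derivable.
by rewrite derive_id /darea !coordE; ring.
Qed.

Lemma darea_Zs p v : (v <= \matrix_(i < 3) Z i p)%MS -> darea p v = 0.
Proof.
move=> /submxP[a ->]; rewrite mulmx_sum_row linear_sum big1// => i _.
by rewrite rowK linearZ/= darea_Z scaler0.
Qed.

Lemma Z_sub p i : (Z i p <= \matrix_(i < 3) Z i p)%MS.
Proof. by rewrite -(rowK (fun i => Z i p)) row_sub. Qed.

Lemma sqrtZ_sub p j : (sqrtZ j p <= \matrix_(i < 3) Z i p)%MS.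
Proof.
by rewrite /sqrtZ; case: ifP => _ /=; rewrite addmx_sub ?eqmx_opp ?Z_sub.
Qed.

(** The new direction has equal coefficients on the [Z i], while those of the two generators sum to
    zero: together they span all of [Z 0], [Z 1], [Z 2]. *)
Lemma lie_sqrtZ p :
  sqrtZ 1 (sqrtZ 0 p) - sqrtZ 0 (sqrtZ 1 p) = - (Z 0 p + Z 1 p + Z 2 p).
Proof.
rewrite sqrtZ0 sqrtZ1 /=; apply: eq_xcyc; apply: ord3P;
  rewrite !(coordE, xc_Z, yc_Z) ?addI3E ?eqxx ?eqI3E /=; ring.
Qed.

Variable S : set E.
Hypothesis SM : S `<=` M.
Hypothesis tS : forall p v, S p -> darea p v = 0 -> tangent_vector S p v.

Local Notation D := (Span M S (@sqrtZ R)).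

(** [X] is a combination of the generators on [S] only, but [v] is tangent to [S], so that
    combination may be differentiated instead. The [b j] are the derivatives of its coefficients. *)
Lemma derive_Span_sqrtZ X p v : D X -> S p -> darea p v = 0 ->
  exists2 a : 'I_2 -> R, X p = \sum_(j < 2) a j *: sqrtZ j p &
  exists b : 'I_2 -> R, 'D_v X p = \sum_(j < 2) (b j *: sqrtZ j p + a j *: sqrtZ j v).
Proof.
move=> [sX [c sc Xc]] Sp dv; have Mp := SM Sp.
exists (c^~ p); first exact: Xc.
exists (fun j => 'D_v (c j) p).
have sF := smooth_comb open_Mset sc (smooth_sqrtZ M).
rewrite (derive_eq_tangent (tS Sp dv) (smooth_differentiable sX Mp) (smooth_differentiable sF Mp) Xc).
rewrite (derive_comb v open_Mset Mp sc (smooth_sqrtZ M)).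
by apply: eq_bigr => j _; rewrite (derive_linear (linear_sqrtZ j)).
Qed.

Lemma Span_sqrtZ_sub X p : D X -> S p -> (X p <= \matrix_(i < 3) Z i p)%MS.
Proof.
move=> [_ [c _ Xc]] Sp; rewrite Xc//; apply: summx_sub => j _.
by apply: scalemx_sub; exact: sqrtZ_sub.
Qed.

(** The terms with differentiated coefficients stay in the span of the generators; the rest is
    antisymmetric, a 2 by 2 determinant of coefficients times the bracket of the generators. *)
Lemma bracket_sqrtZ_sub X Y p : D X -> D Y -> S p ->
  (lie_bracket X Y p <= \matrix_(i < 3) Z i p)%MS.
Proof.
move=> DX DY Sp.
have dX := darea_Zs (Span_sqrtZ_sub DX Sp).
have dY := darea_Zs (Span_sqrtZ_sub DY Sp).
have [a Xa [a' DXa]] := derive_Span_sqrtZ DX Sp dY.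
have [b Yb [b' DYb]] := derive_Span_sqrtZ DY Sp dX.
have -> : lie_bracket X Y p = (b' 0 - a' 0) *: sqrtZ 0 p + (b' 1 - a' 1) *: sqrtZ 1 p
    - (a 0 * b 1 - a 1 * b 0) *: (Z 0 p + Z 1 p + Z 2 p).
  have sqrtZ_lin j (c : 'I_2 -> R) : sqrtZ j (\sum_(k < 2) c k *: sqrtZ k p) =
      c 0 *: sqrtZ j (sqrtZ 0 p) + c 1 *: sqrtZ j (sqrtZ 1 p).
    by rewrite sumI2 linear_sqrtZ -[_ *: sqrtZ 1 p]addr0 linear_sqrtZ (raddf0 (sqrtZ j)) addr0.
  rewrite /lie_bracket DXa DYb Xa Yb !(sumI2 (fun j => _ *: _ + _)) !sqrtZ_lin.
  rewrite -[Z 0 p + _ + _]opprK -lie_sqrtZ.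
  move: (sqrtZ 0 p) (sqrtZ 1 p) => w0 w1.
  move: (sqrtZ 0 w0) (sqrtZ 0 w1) (sqrtZ 1 w0) (sqrtZ 1 w1) => w00 w01 w10 w11.
  by apply: eq_xcyc => i; rewrite !coordE; ring.
by rewrite !(addmx_sub, eqmx_opp, scalemx_sub, sqrtZ_sub, Z_sub).
Qed.

(* The [Z_i] being orthogonal and nonvanishing, the coefficients are smooth quotients. *)
Lemma Span_Z_pointwise X : smooth M X ->
  (forall p, S p -> (X p <= \matrix_(i < 3) Z i p)%MS) -> Span M S (@Z R) X.
Proof.
move=> sX XZ; split=> //.
pose a i p := xc p (i + 1) - xc p (i + 2); pose b i p := yc p (i + 1) - yc p (i + 2).
exists (fun i p => (xc (X p) i * a i p + yc (X p) i * b i p) / (a i p ^+ 2 + b i p ^+ 2)).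
  move=> i k; have oM := @open_Mset R.
  have Ca : Ck k M (a i) by apply: CkB => //; apply: Ck_xc => //; exact: Ck_id.
  have Cb : Ck k M (b i) by apply: CkB => //; apply: Ck_yc => //; exact: Ck_id.
  apply: CkM => //.
    by apply: CkD => //; apply: CkM => //; [apply: Ck_xc|apply: Ck_yc] => //; exact: sX.
  apply: CkV => //; first by move=> p Mp; exact: Z_neq0.
  by under eq_fun do rewrite !expr2; apply: CkD => //; exact: CkM.
move=> p Sp; have Mp := SM Sp; have /submxP[c Xp] := XZ p Sp.
have {}Xp : X p = \sum_(i < 3) c 0 i *: Z i p.
  by rewrite Xp mulmx_sum_row; apply: eq_bigr => i _; rewrite rowK.
rewrite {1}Xp; apply: eq_bigr => i _; congr (_ *: _).
rewrite Xp xc_comb yc_comb -/(a i p) -/(b i p) -!mulrA -!expr2 -mulrDr mulfK//.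
exact: Z_neq0.
Qed.

Lemma Span_generator U m (X : 'I_m -> E -> E) i : smooth U (X i) -> Span U S X (X i).
Proof.
move=> sX; split=> //; exists (fun j _ => (j == i)%:R) => [j k|p _].
  exact: Ck_cst.
rewrite (bigD1 i)//= eqxx scale1r big1 ?addr0// => j /negPf ->.
by rewrite scale0r.
Qed.

Lemma first_derived : sum_distr M S (brackets M S D) D = Span M S (@Z R).
Proof.
apply/seteqP; split=> V.
  move=> [sV [X [Y [[sX [m [X1 [Y1 [DXY [c _ Xc]]]]]] DY VXY]]]].
  apply: Span_Z_pointwise => // p Sp; rewrite VXY// addmx_sub//.
    rewrite Xc//; apply: summx_sub => i _; apply: scalemx_sub.
    by have [] := DXY i; move=> *; exact: bracket_sqrtZ_sub.
  exact: Span_sqrtZ_sub.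
move=> [sV [c sc Vc]]; split=> //.
(* [g] is the mean of the coefficients: removing [g] times the sum of the [Z i] leaves coefficients
   of sum zero, which the generators produce with weights [b]. *)
pose g p := 3^-1 * (c 0 p + c 1 p + c 2 p).
pose b (j : 'I_2) p := if val j == 0%N then g p - c 1 p else c 2 p - g p.
have oM := @open_Mset R.
have sg : smooth M g.
  move=> k; apply: CkM => //; first exact: Ck_cst.
  by do 2?[apply: CkD => //]; exact: sc.
have sb j : smooth M (b j).
  move=> k; case: j => -[|[|//]] ltj; rewrite /b /=; apply: CkB => //; try exact: sc; exact: sg.
have sng : smooth M (fun p => - g p) by move=> k; apply: CkN => //; exact: sg.
have brE p : lie_bracket (sqrtZ 0) (sqrtZ 1) p = - (Z 0 p + Z 1 p + Z 2 p).
  by rewrite (lie_bracket_linear _ (linear_sqrtZ 0) (linear_sqrtZ 1)) lie_sqrtZ.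
have sbr : smooth M (lie_bracket (@sqrtZ R 0) (sqrtZ 1)).
  apply: smooth_linear => a u v; rewrite !brE !linearP/=.
  by apply: eq_xcyc => i; rewrite !coordE; ring.
exists (fun p => \sum_(i < 1) - g p *: lie_bracket (sqrtZ 0) (sqrtZ 1) p),
  (fun p => \sum_(j < 2) b j p *: sqrtZ j p); split.
- split; first by apply: (@smooth_comb _ _ _ 1 (fun _ p => - g p)).
  exists 1%N, (fun=> sqrtZ 0), (fun=> sqrtZ 1); split.
    by move=> _; split; apply: Span_generator; exact: smooth_sqrtZ.
  by exists (fun _ p => - g p).
- split; last by exists b.
  by apply: smooth_comb => // j; exact: smooth_sqrtZ.
move=> p Sp; rewrite Vc// sumI3 sumI2 big_ord1 brE sqrtZ0 sqrtZ1 /b /g /=.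
by apply: eq_xcyc => i; rewrite !coordE; field.
Qed.

Lemma derived_flag_darea I X p : derived_flag M S D I X -> S p -> darea p (X p) = 0.
Proof.
elim: I X p => [|I IH] X p /=; first by move=> DX Sp; exact/darea_Zs/Span_sqrtZ_sub.
have sfl Y : derived_flag M S D I Y -> smooth M Y by apply: derived_flag_smooth => Y' [].
move=> [_ [Y [W [[_ [m [X1 [Y1 [DXY [c _ Yc]]]]]] FW XYW]]]] Sp.
rewrite XYW// linearD/= (IH W)// addr0 Yc// linear_sum big1// => i _.
rewrite linearZ/=; have [FX FY] := DXY i.
suff -> : darea p (lie_bracket (X1 i) (Y1 i) p) = 0 by rewrite scaler0.
have Mp := SM Sp.
have dfl Y' : derived_flag M S D I Y' -> differentiable Y' p.
  by move=> /sfl sY; exact: smooth_differentiable sY Mp.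
(* Differentiating the identity [darea q (Y' q) = 0] along [X' p] gives a right-hand side symmetric
   in the two fields, so the two halves of the bracket cancel. *)
have half X' Y' : derived_flag M S D I X' -> derived_flag M S D I Y' ->
    darea p ('D_(X' p) Y' p) = - darea (X' p) (Y' p).
  move=> FX' FY'; apply/eqP; rewrite -addr_eq0 -derive_darea; last exact: dfl.
  (* The identity holds on [S] only; by induction [X' p] lies in the kernel of [darea p], hence is
     tangent to [S]. *)
  have -> : 'D_(X' p) (fun q => darea q (Y' q)) p = 'D_(X' p) (fun=> 0 : R) p.
    apply: (derive_eq_tangent (tS Sp (IH _ _ FX' Sp))) => [||q Sq].
    - under eq_fun do rewrite darea_polar.
      have dA (F : E -> E) : differentiable F p -> differentiable (fun q => area (F q)) p.
        move=> dF; apply: differentiable_comp => //.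
        exact: smooth_differentiable (smooth_area openT) _.
      apply: differentiableB; first apply: differentiableB; apply: dA => //; last exact: dfl.
      by apply: differentiableD => //; exact: dfl.
    - exact: differentiable_cst.
    - exact: IH.
  by rewrite derive_cst.
by rewrite /lie_bracket linearB/= !half// (dareaC (Y1 i p)) subrr.
Qed.
End Flag.

(** * A frame of the kernel of the area differential, and the ranks of the flag *)

Section Rank5.
Context {R : realType}.
Local Notation E := 'rV[R]_6.
Local Notation M := (Mset R).
Implicit Types (p q u v : E).

(** The bracket of [Z i] and [Z j], in the closed form available for linear fields. *)
Definition lieZ (i j : 'I_3) p : E := Z j (Z i p) - Z i (Z j p).

Definition frame5 (k : 'I_5) : E -> E :=
  if val k == 0%N then Z 0 else if val k == 1%N then Z 1 else if val k == 2%N then Z 2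
  else if val k == 3%N then lieZ 0 1 else lieZ 1 2.

Lemma sumI5 (V : nmodType) (F : 'I_5 -> V) :
  \sum_(k < 5) F k = F 0 + F 1 + F 2%:R + F 3%:R + F 4%:R.
Proof.
rewrite !big_ord_recl big_ord0 addr0 !addrA.
by congr (F _ + F _ + F _ + F _ + F _); exact/val_inj.
Qed.

Lemma Z_ants p :
  ((Z 0 p = ants (xc p 1 - xc p 2) (yc p 1 - yc p 2) 0 0 0 0)%R *
   (Z 1 p = ants 0 0 (xc p 2 - xc p 0) (yc p 2 - yc p 0) 0 0)%R *
   (Z 2 p = ants 0 0 0 0 (xc p 0 - xc p 1) (yc p 0 - yc p 1))%R)%type.
Proof.
by do !split; apply: eq_xcyc; apply: ord3P; rewrite ?xc_ants ?yc_ants ?xc_Z ?yc_Z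
  ?addI3E ?eqxx ?eqI3E ?mul1r ?mul0r.
Qed.

Lemma lieZ_ants p :
  ((lieZ 0 1 p = ants (xc p 0 - xc p 2) (yc p 0 - yc p 2)
                      (xc p 2 - xc p 1) (yc p 2 - yc p 1) 0 0)%R *
   (lieZ 1 2 p = ants 0 0 (xc p 1 - xc p 0) (yc p 1 - yc p 0)
                      (xc p 0 - xc p 2) (yc p 0 - yc p 2))%R)%type.
Proof.
rewrite /lieZ !Z_ants !xc_ants !yc_ants.
by split; apply: eq_xcyc; apply: ord3P;
  rewrite ?xcD ?xcN ?ycD ?ycN ?xc_ants ?yc_ants; ring.
Qed.

Lemma cramer0 (a b x y z w : R) : x * w - y * z != 0 ->
  a * x + b * z = 0 -> a * y + b * w = 0 -> a = 0 /\ b = 0.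
Proof.
move=> d0 e1 e2.
have /eqP : a * (x * w - y * z) = 0.
  transitivity (w * (a * x + b * z) - z * (a * y + b * w)); first by ring.
  by rewrite e1 e2 !mulr0 subr0.
have /eqP : b * (x * w - y * z) = 0.
  transitivity (x * (a * y + b * w) - y * (a * x + b * z)); first by ring.
  by rewrite e1 e2 !mulr0 subr0.
by rewrite !mulf_eq0 (negPf d0) !orbF => /eqP -> /eqP ->.
Qed.

(** Ant [0] is moved only by [Z 0] and [lieZ 0 1], ant [2] only by [Z 2] and [lieZ 1 2]. Each pair
    gives a 2 by 2 system whose determinant is twice the area up to sign; then [Z 1] is left
    alone. *)
Lemma row_free_frame5 p : M p -> row_free (\matrix_(k < 5) frame5 k p).
Proof.
move=> Mp; have := Mp => /MsetE; rewrite areaE => A0.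
apply: row_free_rows => c c0.
have {}c0 : c 0 *: Z 0 p + c 1 *: Z 1 p + c 2%:R *: Z 2 p + c 3%:R *: lieZ 0 1 p
    + c 4%:R *: lieZ 1 2 p = 0 by rewrite -c0 sumI5.
rewrite !Z_ants !lieZ_ants in c0.
have X i := congr1 (fun u => xc u i) c0; have Y i := congr1 (fun u => yc u i) c0.
have := (X 0, Y 0); have := (X 2, Y 2); have := (X 1, Y 1) => {X Y c0}.
rewrite /= !(xcD, xcZ, ycD, ycZ, xc0, yc0) !xc_ants !yc_ants.
rewrite ?mulr0 ?addr0 ?add0r => -[X1 Y1] [X2 Y2] [X0 Y0].
have [c00 c3] : c 0 = 0 /\ c 3%:R = 0.
  apply: cramer0 X0 Y0; apply: contraNneq A0 => d0; apply/eqP.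
  by move: d0; lra.
have [c2 c4] : c 2%:R = 0 /\ c 4%:R = 0.
  apply: cramer0 X2 Y2; apply: contraNneq A0 => d0; apply/eqP.
  by move: d0; lra.
have c1 : c 1 = 0.
  move: X1 Y1; rewrite c3 c4 !mul0r !addr0 => X1 Y1.
  (* The second column, with coefficient zero, is another edge chosen so that the determinant is
     again twice the area up to sign. *)
  have [] // := @cramer0 (c 1) 0 (xc p 2 - xc p 0) (yc p 2 - yc p 0)
    (xc p 1 - xc p 0) (yc p 1 - yc p 0).
  - by apply: contraNneq A0 => d0; apply/eqP; move: d0; lra.
  - by rewrite X1 mul0r addr0.
  - by rewrite Y1 mul0r addr0.
case=> -[|[|[|[|[|//]]]]] ltk.
- by rewrite -c00; congr c; exact/val_inj.
- by rewrite -c1; congr c; exact/val_inj.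
- by rewrite -c2; congr c; exact/val_inj.
- by rewrite -c3; congr c; exact/val_inj.
- by rewrite -c4; congr c; exact/val_inj.
Qed.

Lemma darea_frame5 k p : darea p (frame5 k p) = 0.
Proof.
rewrite /frame5; do 3![case: ifP => _; first exact: darea_Z].
by case: ifP => _; rewrite lieZ_ants /darea !xc_ants !yc_ants; ring.
Qed.

(** A dimension count: five independent vectors inside the kernel of a nonzero linear form on a
    space of dimension 6. *)
Lemma frame5_eq p v : M p -> (v <= \matrix_(k < 5) frame5 k p)%MS <-> darea p v = 0.
Proof.
move=> Mp; pose C : 'cV[R]_6 := \col_j darea p (delta_mx 0 j).
have CE u : u *m C = (darea p u)%:M.
  apply/matrixP => i j; rewrite !ord1 !mxE eqxx mulr1n {2}(row_sum_delta u).
  by rewrite linear_sum; apply: eq_bigr => k _; rewrite linearZ/= mxE.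
have subK u : (u <= kermx C)%MS <-> darea p u = 0.
  split=> [/sub_kermxP|du]; last by apply/sub_kermxP; rewrite CE du raddf0.
  by rewrite CE => /matrixP/(_ 0 0); rewrite !mxE eqxx.
have FK : (\matrix_(k < 5) frame5 k p <= kermx C)%MS.
  by apply/row_subP => k; rewrite rowK; apply/subK; exact: darea_frame5.
have rC : \rank C = 1%N.
  apply/eqP; rewrite eqn_leq rank_leq_col lt0n mxrank_eq0; apply/eqP => C0.
  (* The form is nonzero because its value at [p] itself is twice the area, the area being
     homogeneous of degree 2. *)
  have := CE p; rewrite C0 mulmx0 => /matrixP/(_ 0 0); rewrite !mxE eqxx mulr1n => /esym.
  move=> d0; have /MsetE/eqP := Mp; apply.
  by move: d0; rewrite areaE /darea; lra.
have KF : (kermx C <= \matrix_(k < 5) frame5 k p)%MS.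
  have [_ <-] := mxrank_leqif_sup FK.
  by have /eqP -> := row_free_frame5 Mp; rewrite mxrank_ker rC.
by rewrite -subK; split=> [/submx_trans|/submx_trans]; apply.
Qed.

Variable S : set E.
Hypothesis SM : S `<=` M.
Hypothesis tS : forall p v, S p -> darea p v = 0 -> tangent_vector S p v.

Local Notation D := (Span M S (@sqrtZ R)).

Lemma linear_lieZ i j : linear (lieZ i j).
Proof.
move=> a u v; rewrite /lieZ !linear_Z.
move: (Z j (Z i u)) (Z i (Z j u)) (Z j (Z i v)) (Z i (Z j v)) => u1 u2 v1 v2.
by rewrite scalerBr addrACA opprD.
Qed.

Lemma frame5_second_derived p v : S p -> (v <= \matrix_(k < 5) frame5 k p)%MS ->
  fiber_at (derived_flag M S D 2) p v.
Proof.
move=> Sp /submxP[c ->]; have oM := @open_Mset R.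
have DE : derived_flag M S D 1 = Span M S (@Z R) by exact: first_derived.
have sf k : smooth M (frame5 k).
  by rewrite /frame5; repeat (case: ifP => _);
    first [exact: smooth_Z | apply: smooth_linear; exact: linear_lieZ].
have sm m (a : 'I_m -> R) (X : 'I_m -> E -> E) : (forall i, smooth M (X i)) ->
    smooth M (fun q => \sum_(i < m) a i *: X i q).
  by move=> sX; apply: (@smooth_comb _ _ _ m (fun i _ => a i)) => // i k; exact: Ck_cst.
exists (fun q => \sum_(k < 5) c 0 k *: frame5 k q); last first.
  by rewrite mulmx_sum_row; apply: eq_bigr => k _; rewrite rowK.
split; first exact: sm.
rewrite -/(derived_flag M S D 1) DE.
pose X1 (i : 'I_2) : E -> E := if val i == 0%N then Z 0 else Z 1.
pose Y1 (i : 'I_2) : E -> E := if val i == 0%N then Z 1 else Z 2.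
pose a (i : 'I_2) := if val i == 0%N then c 0 3%:R else c 0 4%:R.
pose b (i : 'I_3) := if val i == 0%N then c 0 0 else if val i == 1%N then c 0 1 else c 0 2%:R.
have sbr i : smooth M (lie_bracket (X1 i) (Y1 i)).
  have -> : lie_bracket (X1 i) (Y1 i) = if val i == 0%N then lieZ 0 1 else lieZ 1 2.
    by apply/funext => q; rewrite /X1 /Y1; case: ifP => _;
      rewrite (lie_bracket_linear _ (linear_Z _) (linear_Z _)).
  by case: ifP => _; apply: smooth_linear; exact: linear_lieZ.
exists (fun q => \sum_(i < 2) a i *: lie_bracket (X1 i) (Y1 i) q),
  (fun q => \sum_(i < 3) b i *: Z i q); split.
- split; first exact: sm.
  exists 2%N, X1, Y1; split.
    by move=> i; rewrite /X1 /Y1; case: ifP => _; split; apply: Span_generator; exact: smooth_Z.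
  by exists (fun i _ => a i) => // i k; exact: Ck_cst.
- split; first by apply: sm => i; exact: smooth_Z.
  by exists (fun i _ => b i) => // i k; exact: Ck_cst.
move=> q _; rewrite sumI5 sumI2 sumI3 /a /b /X1 /Y1 /frame5 /=.
rewrite !(lie_bracket_linear _ (linear_Z _) (linear_Z _)) -!/(lieZ _ _ q).
move: (Z 0 q) (Z 1 q) (Z 2 q) (lieZ 0 1 q) (lieZ 1 2 q) => z0 z1 z2 l1 l2.
by apply: eq_xcyc => i; rewrite !coordE; ring.
Qed.

(** From step 2 on, the fibers stay in the kernel of the area differential and already contain its
    frame. *)
Lemma has_rank_derived_flag I :
  has_rank S (derived_flag M S D I) (nth 5 [:: 2; 3; 5]%N I).
Proof.
case: I => [|[|I]]; first exact: has_rank_sqrtZ.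
  by rewrite [derived_flag _ _ _ _]first_derived//; exact: has_rank_Z.
(* The default value 5 of [nth] covers the steps past the end of the list. *)
rewrite (_ : nth _ _ _ = 5%N); last by case: I => [|[]].
move=> p Sp; exists (\matrix_(k < 5) frame5 k p); first exact/row_free_frame5/SM.
apply/seteqP; split=> v /=.
  move=> [X FX <-]; apply/frame5_eq; first exact: SM.
  exact: (@derived_flag_darea _ _ SM tS I.+2 X p FX Sp).
move=> /(frame5_second_derived Sp) [X FX Xv]; exists X => //.
(* Each step of the flag contains the previous one, so a field found at step 2 persists. *)
elim: I => [//|I IH]; apply: sum_distr_sub => //.
by move=> Y [].
Qed.

End Rank5.

(** * Growth vector on the leaves, square root, and integral curves *)

Section LeafFlag.
Context {R : realType}.
Local Notation E := 'rV[R]_6.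

Lemma growth_vector_leaf (A : R) : A != 0 ->
  has_growth_vector (Mset R) (leaf R A) (distrD_on_leaf R A) [:: 2; 3; 5]%N.
Proof.
move=> A0; split=> // I; apply: has_rank_derived_flag => [p []//|p v].
exact: tangent_leaf.
Qed.

Lemma distrB_sqrt : distrB R = sum_distr (Mset R) (Mset R)
  (brackets (Mset R) (Mset R) (distrD R)) (distrD R).
Proof. by rewrite /distrD first_derived// => p v; exact: tangent_Mset. Qed.

Lemma distrB_darea (p v : E) : Mset R p -> fiber_at (distrB R) p v -> darea p v = 0.
Proof.
move=> Mp; rewrite /distrB fiber_Span//; [exact: darea_Zs|exact: open_Mset|].
by move=> i; exact: smooth_Z.
Qed.

Lemma tangent_distrB (A : R) : A != 0 -> tangent_to (leaf R A) (distrB R).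
Proof.
move=> A0 p Lp v /distrB_darea dv; apply: tangent_leaf => //; apply: dv.
by case: Lp.
Qed.

(** The area has zero derivative at interior times and is continuous on [J], so the mean value
    theorem on each [[s, t]] in [J] makes it constant. *)
Lemma integral_curve_leaf (J : set R) (gm : R -> E) :
  integral_curve J (Mset R) (distrB R) gm ->
  exists2 A : R, A != 0 & forall t, J t -> leaf R A (gm t).
Proof.
move=> [iJ cg Mg dg].
have [[t0 Jt0]|J0] := pselect (exists t, J t); last first.
  (* For an empty interval any nonzero value will do. *)
  by exists 1 => [|t Jt]; [exact: oner_neq0|case: J0; exists t].
pose f t := area (gm t).
have cst s t : J s -> J t -> s < t -> f s = f t.
  move=> Js Jt st.
  have sJ : `[s, t] `<=` J.
    by move=> x /=; rewrite in_itv/= => sxt; exact: (iJ s t).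
  have df x : x \in `]s, t[ -> is_derive x 1 f 0.
    move=> xst.
    have Jx : J° x.
      apply: (@interiorS _ `]s, t[%classic).
        by apply: subset_trans sJ; exact: subset_itv_oo_cc.
      by rewrite (interior_id _).1//; exact: itv_open.
    have [dx fx] := dg x Jx.
    have dgx : differentiable gm x by exact/derivable1_diffP.
    have Mx : Mset R (gm x) by apply: Mg; exact: interior_subset Jx.
    apply: DeriveDef.
      apply/derivable1_diffP/differentiable_comp => //.
      exact: smooth_differentiable (smooth_area openT) _.
    by rewrite derive_area_comp// -derive1E; exact: distrB_darea.
  have cf : {within `[s, t], continuous f}.
    move=> x; apply: (@continuous_comp (subspace `[s, t]) _ _ gm (@area R) x).
      exact: (continuous_subspaceW sJ cg).
    exact: area_continuous.
  have [c _ /eqP] := MVT st df cf.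
  by rewrite mul0r subr_eq0 => /eqP.
exists (f t0); first by apply/MsetE; exact: Mg.
move=> t Jt; split; first exact: Mg.
by have [tt|tt|->//] := ltgtP t t0; [|symmetry]; exact: cst.
Qed.

End LeafFlag.

(** * The foliation *)

(** Each path image is a connected subset of [B] through [p0], so it lies in the component of
    [p0]. *)
Lemma path_connected_connected (R : realType) (T : topologicalType) (B : set T) (p0 : T) :
  (forall p, B p -> exists g : R -> T, [/\ g 0 = p0, g 1 = p &
     forall t, 0 <= t <= 1 -> {for t, continuous g} /\ B (g t)]) ->
  connected B.
Proof.
move=> H; suff -> : B = connected_component B p0 by exact: component_connected.
apply/seteqP; split; last exact: connected_component_sub.
move=> p Bp; have [g [g0 g1 gB]] := H p Bp.
have in01 (t : R) : `[0, 1]%classic t -> 0 <= t <= 1 by rewrite /= in_itv.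
have cI : connected (g @` `[0, 1]%classic).
  apply: connected_continuous_connected.
    by apply/connected_intervalP; exact: interval_is_interval.
  by apply: continuous_in_subspaceT => t /[1!inE]/in01 /gB[].
have m01 (t : R) : 0 <= t <= 1 -> (g @` `[0, 1]%classic) (g t).
  by move=> t01; exists t => //=; rewrite in_itv.
have sB : g @` `[0, 1]%classic `<=` B by move=> _ [t /in01 /gB[_ ?] <-].
have := @connected_component_max _ _ _ p0 _ sB cI; apply.
  by rewrite -g0; apply: m01; rewrite lexx ler01.
by rewrite -g1; apply: m01; rewrite lexx ler01.
Qed.

(** The arc cosine of [a] has sine [|b|]; the sign of [b] decides whether to take its opposite. *)
Lemma polar_angle (R : realType) (a b : R) : a ^+ 2 + b ^+ 2 = 1 ->
  exists th, cos th = a /\ sin th = b.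
Proof.
move=> ab; have a1 : -1 <= a <= 1.
  by apply/andP; split; nra.
have sa : sin (acos a) = `|b|.
  by rewrite sin_acos// -ab addrAC subrr add0r sqrtr_sqr.
have ca : cos (acos a) = a by rewrite acosK// in_itv.
have [b0|b0] := leP 0 b.
  by exists (acos a); rewrite sa ger0_norm.
by exists (- acos a); rewrite cosN sinN sa ltr0_norm// opprK.
Qed.

(** * Parametrization and connectedness of a leaf *)

Section LeafConnected.
Context {R : realType}.
Local Notation E := 'rV[R]_6.

(* [r_3 = (c, d)], [u = r_2 - r_3] has polar coordinates [(exp tau, th)], and
   [r_1 - r_3] is [s u] plus the multiple of [u] rotated by a right angle giving area [A]. *)
Definition leaf_param (A c d tau th s : R) : E :=
  let r := expR tau in let r' := expR (- tau) in
  ants (c + s * (r * cos th) - 2 * A * r' * sin th)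
       (d + s * (r * sin th) + 2 * A * r' * cos th)
       (c + r * cos th) (d + r * sin th) c d.

Lemma area_leaf_param A c d tau th s : area (leaf_param A c d tau th s) = A.
Proof.
rewrite areaE !xc_ants !yc_ants.
have e1 : expR tau * expR (- tau) = 1 by rewrite -expRD subrr expR0.
have cs := cos2Dsin2 th.
(* The shear [s] moves the first ant parallel to the opposite edge and drops out of the area. *)
transitivity (A * (expR tau * expR (- tau)) * (cos th ^+ 2 + sin th ^+ 2)); first by field.
by rewrite e1 cs !mulr1.
Qed.

Lemma leaf_param_surj A p : A != 0 -> area p = A ->
  exists c d tau th s, p = leaf_param A c d tau th s.
Proof.
move=> A0 pA; pose a := xc p 1 - xc p 2; pose b := yc p 1 - yc p 2.
pose w := xc p 0 - xc p 2; pose z := yc p 0 - yc p 2.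
have Mp : Mset R p by apply/MsetE; rewrite pA.
have n0 : a ^+ 2 + b ^+ 2 != 0 by have := Z_neq0 0 Mp; rewrite !addI3E.
have npos : 0 < a ^+ 2 + b ^+ 2 by rewrite lt_def n0 addr_ge0 ?sqr_ge0.
pose r := Num.sqrt (a ^+ 2 + b ^+ 2).
have r0 : 0 < r by rewrite sqrtr_gt0.
have r2 : r ^+ 2 = a ^+ 2 + b ^+ 2 by rewrite sqr_sqrtr// ltW.
have rn : r != 0 by rewrite gt_eqF.
have [th [cth sth]] : exists th, cos th = a / r /\ sin th = b / r.
  by apply: polar_angle; rewrite !expr_div_n -mulrDl -r2 divff// expf_neq0.
(* In the orthogonal basis formed by the edge [(a, b)] and its rotation by a right angle, [(w, z)]
   has components given by a dot product, which yields [s], and by this cross product. *)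
have cr : z * a - w * b = 2 * A by rewrite -pA areaE /z /w /a /b; field.
exists (xc p 2), (yc p 2), (ln r), th, ((w * a + z * b) / r ^+ 2).
rewrite /leaf_param expRN !lnK ?posrE// cth sth.
have ar : r * (a / r) = a by rewrite mulrC divfK.
have br : r * (b / r) = b by rewrite mulrC divfK.
rewrite ar br -cr.
have Ex : xc p 0 = xc p 2 + (w * a + z * b) / r ^+ 2 * a - (z * a - w * b) / r * (b / r).
  transitivity (xc p 2 + w * ((a ^+ 2 + b ^+ 2) / r ^+ 2)).
    by rewrite -r2 divff ?expf_neq0// mulr1 /w addrC subrK.
  by field.
have Ey : yc p 0 = yc p 2 + (w * a + z * b) / r ^+ 2 * b + (z * a - w * b) / r * (a / r).
  transitivity (yc p 2 + z * ((a ^+ 2 + b ^+ 2) / r ^+ 2)).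
    by rewrite -r2 divff ?expf_neq0// mulr1 /z addrC subrK.
  by field.
by rewrite -Ex -Ey /a /b ![_ 2 + _]addrC !subrK antsK.
Qed.

(** The five parameters range over all reals, so scaling them by [t] joins any point to the one with
    zero parameters without changing the area. *)
Lemma connected_leaf (A : R) : A != 0 -> connected (leaf R A).
Proof.
move=> A0; apply: (@path_connected_connected R _ _ (leaf_param A 0 0 0 0 0)).
move=> p /leafE-/(_ A0)/(leaf_param_surj A0)[c [d [tau [th [s pE]]]]].
exists (fun t => leaf_param A (t * c) (t * d) (t * tau) (t * th) (t * s)); split.
- by rewrite !mul0r.
- by rewrite !mul1r.
move=> t _; split; last by apply/leafE => //; exact: area_leaf_param.
have CL (x : R) : Ck 0 setT (fun t : R => t * x).
  by apply: CkM; [exact: openT|exact: Ck_id|exact: Ck_cst].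
have CC (f : R -> R) (g : R -> R) : Ck 0 setT g -> continuous f -> Ck 0 setT (fun t => f (g t)).
  by move=> cg cf x _; apply: continuous_comp; [exact: cg|exact: cf].
have Cexp x : Ck 0 setT (fun t : R => expR (t * x)) by apply: CC => //; exact: continuous_expR.
have CexpN x : Ck 0 setT (fun t : R => expR (- (t * x))).
  by apply: CC; [apply: CkN => //; exact: openT|exact: continuous_expR].
have Ccos x : Ck 0 setT (fun t : R => cos (t * x)) by apply: CC => //; exact: continuous_cos.
have Csin x : Ck 0 setT (fun t : R => sin (t * x)) by apply: CC => //; exact: continuous_sin.
have oT : open [set: R] by exact: openT.
have CA : Ck 0 setT (fun _ : R => 2 * A) by exact: Ck_cst.
suff : Ck 0 setT (fun t : R => leaf_param A (t * c) (t * d) (t * tau) (t * th) (t * s)) by apply.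
apply: Ck_ants => //.
- apply: CkB => //; last by apply: CkM => //; exact: CkM.
  by apply: CkD => //; apply: CkM => //; exact: CkM.
- apply: CkD => //; last by apply: CkM => //; exact: CkM.
  by apply: CkD => //; apply: CkM => //; exact: CkM.
- by apply: CkD => //; exact: CkM.
- by apply: CkD => //; exact: CkM.
Qed.

End LeafConnected.

(** * A chart having the area as last coordinate *)

Section Chart.
Context {R : realType}.
Local Notation E := 'rV[R]_6.
Implicit Types (p q w : E).

Lemma same_transverse5 (u v : E) : same_transverse 5 u v <-> yc u 2 = yc v 2.
Proof.
have E5 : iy 2 = ord_max :> 'I_6 by apply/val_inj; rewrite /= inordK.
rewrite /yc E5; split=> [|uv j j5]; first by apply.
suff -> : j = ord_max by [].
by apply/val_inj/eqP; rewrite /= eqn_leq j5 -ltnS ltn_ord.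
Qed.

Lemma ball_segment (x w0 w1 : E) (e t : R) : ball x e w0 -> ball x e w1 ->
  0 <= t <= 1 -> ball x e (w0 + t *: (w1 - w0)).
Proof.
rewrite -!ball_normE /= => b0 b1 /andP[t0 t1].
have -> : x - (w0 + t *: (w1 - w0)) = (1 - t) *: (x - w0) + t *: (x - w1).
  by apply/rowP => j; rewrite !mxE; ring.
apply: le_lt_trans (ler_normD _ _) _; rewrite !normrZ !ger0_norm ?subr_ge0//.
(* The strict inequality is drawn from the term in [t], so [t = 0] is set apart. *)
have [->|tn0] := eqVneq t 0; first by rewrite subr0 mul1r mul0r addr0.
have tp : 0 < t by rewrite lt_def tn0.
rewrite [ltRHS](_ : _ = (1 - t) * e + t * e); last by ring.
apply: ler_ltD; first by rewrite ler_wpM2l ?subr_ge0// ltW.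
by rewrite ltr_pM2l.
Qed.

(* Around [p] take [(al, be) = r_2 - r_3] at [p]: the chart replaces [r_1] by its
   component along this vector and the area, shifted by [c0]. *)
Variables (al be c0 : R).

Definition leaf_chart q : E := ants (al * xc q 0 + be * yc q 0)
  (xc q 1) (yc q 1) (xc q 2) (yc q 2) (area q - c0).

(** In chart coordinates [yc w 0], [xc w 1] hold the second ant and [yc w 1], [xc w 2] the third.
    The first ant solves a 2 by 2 linear system with this determinant. *)
Definition chart_det w := al * (yc w 0 - yc w 1) + be * (xc w 1 - xc w 2).

(** Twice the area minus the part free of the first ant: the right-hand side of the second equation
    of that system. *)
Definition chart_offset w := 2 * (yc w 2 + c0) - (xc w 1 * yc w 1 - yc w 0 * xc w 2).

(** The first two entries are Cramer's rule for the first ant. *)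
Definition leaf_chart_inv w : E := ants
  (((yc w 0 - yc w 1) * xc w 0 - be * chart_offset w) / chart_det w)
  (((xc w 1 - xc w 2) * xc w 0 + al * chart_offset w) / chart_det w)
  (yc w 0) (xc w 1) (yc w 1) (xc w 2).

Lemma leaf_chartK q : chart_det (leaf_chart q) != 0 -> leaf_chart_inv (leaf_chart q) = q.
Proof.
rewrite /leaf_chart_inv /chart_offset /chart_det /leaf_chart !xc_ants !yc_ants => d0.
rewrite -[RHS]antsK areaE; congr ants; field; exact: d0.
Qed.

Lemma leaf_chart_invK w : chart_det w != 0 -> leaf_chart (leaf_chart_inv w) = w.
Proof.
rewrite /leaf_chart areaE /leaf_chart_inv !xc_ants !yc_ants /chart_offset /chart_det => d0.
rewrite -[RHS]antsK; congr ants; field; exact: d0.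
Qed.

Lemma Ck_chart_det k U : open U -> Ck k U chart_det.
Proof.
move=> oU; have Cx i : Ck k U (fun w => xc w i) by apply: Ck_xc => //; exact: Ck_id.
have Cy i : Ck k U (fun w => yc w i) by apply: Ck_yc => //; exact: Ck_id.
by apply: CkD => //; apply: CkM; rewrite //; first [exact: Ck_cst | exact: CkB].
Qed.

Lemma smooth_leaf_chart U : open U -> smooth U leaf_chart.
Proof.
move=> oU k; have Cx i : Ck k U (fun w => xc w i) by apply: Ck_xc => //; exact: Ck_id.
have Cy i : Ck k U (fun w => yc w i) by apply: Ck_yc => //; exact: Ck_id.
apply: Ck_ants => //; last first.
  by apply: CkB => //; [apply: Ck_area => //; exact: Ck_id|exact: Ck_cst].
by apply: CkD => //; apply: CkM => //; exact: Ck_cst.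
Qed.

Lemma smooth_leaf_chart_inv U : open U -> (forall w, U w -> chart_det w != 0) ->
  smooth U leaf_chart_inv.
Proof.
move=> oU U0 k; have Cx i : Ck k U (fun w => xc w i) by apply: Ck_xc => //; exact: Ck_id.
have Cy i : Ck k U (fun w => yc w i) by apply: Ck_yc => //; exact: Ck_id.
have Cd : Ck k U (fun w => (chart_det w)^-1) by apply: CkV => //; exact: Ck_chart_det.
have Cc (x : R) : Ck k U (fun=> x) by exact: Ck_cst.
have Co : Ck k U chart_offset.
  apply: CkB => //; last by apply: CkB => //; exact: CkM.
  by apply: CkM => //; exact: CkD.
apply: Ck_ants => //; apply: CkM => //.
  by apply: CkB => //; apply: CkM => //; exact: CkB.
by apply: CkD => //; apply: CkM => //; exact: CkB.
Qed.

End Chart.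

(** * Foliated charts and the foliation by leaves *)

Section Foliation.
Context {R : realType}.
Local Notation E := 'rV[R]_6.
Implicit Types (p q w : E).

(** The domain is the preimage of a ball on which the chart is invertible; level sets of the area
    become slices of the ball, which are convex and hence connected. *)
Lemma leaf_chart_exists (c0 : R) p : Mset R p -> exists O phi,
  [/\ chart O phi, O p, O `<=` Mset R, forall q, yc (phi q) 2 = area q - c0 &
      forall c, connected [set q : E | O q /\ area q = c]].
Proof.
move=> Mp; pose al := xc p 1 - xc p 2; pose be := yc p 1 - yc p 2.
pose phi := leaf_chart al be c0; pose psi := leaf_chart_inv al be c0.
(* At [p] the determinant is the squared length of the edge [(al, be)]. *)
have det0 : chart_det al be (phi p) != 0.
  rewrite /chart_det /phi /leaf_chart !xc_ants !yc_ants.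
  by have := Z_neq0 0 Mp; rewrite !addI3E !expr2.
have phi5 q : yc (phi q) 2 = area q - c0 by rewrite /phi /leaf_chart yc_ants.
have [e e0 eN] : exists2 e : R, 0 < e &
    forall w, ball (phi p) e w -> chart_det al be w != 0 /\ yc w 2 + c0 != 0.
  have nd : nbhs (phi p) (chart_det al be @^-1` [set x | x != 0]).
    apply: (@Ck_chart_det R al be 0%N setT openT) => //.
    by apply: open_nbhs_nbhs; split=> //; exact: open_neq.
  (* The last coordinate plus [c0] is the area; keeping it nonzero keeps the domain inside
     [Mset R]. *)
  have ny : nbhs (phi p) ((fun w => yc w 2 + c0) @^-1` [set x | x != 0]).
    have : Ck 0 setT (fun w : E => yc w 2 + c0).
      apply: CkD; [exact: openT| |exact: Ck_cst].
      by apply: Ck_yc; [exact: openT|exact: Ck_id].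
    move=> /(_ (phi p) I); apply; apply: open_nbhs_nbhs; split; first exact: open_neq.
    by rewrite /= phi5 subrK; apply/MsetE.
  have /nbhs_ballP[e e0 eN] := @filterI _ _ (nbhs_filter (phi p)) _ _ nd ny.
  by exists e.
pose B := ball (phi p) e; pose O := phi @^-1` B.
have oB : open B by exact: ball_open.
have oO : open O.
  apply: open_comp => // q _.
  exact: (smooth_leaf_chart al be c0 openT 0%N).
have psiK w : B w -> phi (psi w) = w.
  by move=> Bw; apply: leaf_chart_invK; have [] := eN w Bw.
have phiK q : O q -> psi (phi q) = q.
  by move=> Oq; apply: leaf_chartK; have [] := eN _ Oq.
have imO : phi @` O = B.
  apply/seteqP; split=> [_ [q Oq <-]//|w Bw].
  by exists (psi w); rewrite /O /= ?psiK.
have spsi : smooth B psi.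
  by apply: smooth_leaf_chart_inv => // w /eN[].
exists O, phi; split=> //.
- split=> //; first exact: smooth_leaf_chart.
    by rewrite imO.
  by exists psi => //; rewrite imO.
- exact: ballxx.
- move=> q Oq; apply/MsetE; have [_] := eN _ Oq.
  by rewrite phi5 subrK.
move=> c; have [[q0 [Oq0 aq0]]|N] := pselect (exists q, O q /\ area q = c); last first.
  rewrite (_ : [set q | _] = set0); first exact: connected0.
  by apply/seteqP; split=> // q Hq; case: N; exists q.
apply: (@path_connected_connected R _ _ q0) => q [Oq aq].
(* The segment between two chart images with the same last coordinate stays in the ball and in the
   slice; it is pulled back by [psi]. *)
pose seg (t : R) := phi q0 + t *: (phi q - phi q0).
exists (fun t => psi (seg t)); split.
- by rewrite /seg scale0r addr0 phiK.
- by rewrite /seg scale1r addrC subrK phiK.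
move=> t t01; have Bt : B (seg t) by exact: ball_segment.
split.
  apply: continuous_comp; last exact: (spsi 0%N).
  apply: differentiable_continuous; apply: differentiableD => //.
split; first by rewrite /O /= psiK.
apply: (addIr (- c0)); rewrite -phi5 psiK// /seg !coordE !phi5 aq aq0 subrr mulr0 addr0.
by [].
Qed.

Lemma foliated_leaf : foliated_by 5 (Mset R) [set A : R | A != 0] (leaf R).
Proof.
split.
- split.
  + apply/seteqP; split=> p; first by move=> [A _ []].
    by move=> Mp; exists (area p); [exact/MsetE|].
  + by move=> A B _ _ [p [[_ <-] [_ <-]]].
  + move=> A A0; exists (ants 0 (2 * A) 1 0 0 0); apply/leafE => //.
    by rewrite areaE !xc_ants !yc_ants; field.
- move=> A A0; split; first exact: connected_leaf.
  move=> p Lp; have [Mp pA] := Lp.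
  (* The shift by [A] puts the leaf at the zero slice, as the definition of a submanifold
     requires. *)
  have [U [phi [ch Up UM phi5 _]]] := leaf_chart_exists A Mp.
  exists U, phi; split=> //; apply/seteqP; split=> q /=.
    by move=> [[_ qA] Uq]; split=> //; apply/same_transverse5; rewrite phi5 qA subrr yc0.
  move=> [Uq /same_transverse5]; rewrite phi5 yc0 => /eqP; rewrite subr_eq0 => /eqP qA.
  by split=> //; split=> //; exact: UM.
- move=> p Mp; have [U [phi [ch Up UM phi5 cU]]] := leaf_chart_exists 0 Mp.
  exists U, phi; split=> // A q A0 LUq; have [[Mq qA] Uq] := LUq.
  have LO : leaf R A `&` U = [set q' | U q' /\ area q' = A].
    by apply/seteqP; split=> x [] => [[_ ?] ?|Ox xA]; split=> //; split=> //; exact: UM.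
  (* The trace of the leaf is a connected level set, so it is its own component. *)
  rewrite connected_component_id//; last by rewrite LO; exact: cU.
  rewrite LO; apply/seteqP; split=> x [Ox H]; split=> //.
    by apply/same_transverse5; rewrite !phi5 H qA.
  by move/same_transverse5: H; rewrite !phi5 => /addIr ->.
Qed.

End Foliation.

Theorem proposition3p2 (R : realType) :
  (open (Mset R) /\ has_rank (Mset R) (distrB R) 3) /\
  (* (1) *)
  [/\ foliated_by 5 (Mset R) [set A : R | A != 0] (leaf R),
      forall A : R, A != 0 -> tangent_to (leaf R A) (distrB R) &
      forall (J : set R) (gamma : R -> 'rV[R]_6),
        integral_curve J (Mset R) (distrB R) gamma ->
        exists2 A : R, A != 0 & forall t, J t -> leaf R A (gamma t)] /\
  (* (2) *)
  (has_rank (Mset R) (distrD R) 2 /\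
   distrB R =
     sum_distr (Mset R) (Mset R)
       (brackets (Mset R) (Mset R) (distrD R)) (distrD R)) /\
  (* (3) *)
  (forall A : R, A != 0 ->
     has_growth_vector (Mset R) (leaf R A) (distrD_on_leaf R A) [:: 2; 3; 5]%N).
Proof.
split; first by split; [exact: open_Mset|exact: has_rank_Z].
split; first by split; [exact: foliated_leaf|exact: tangent_distrB|exact: integral_curve_leaf].
split; last exact: growth_vector_leaf.
by split; [exact: has_rank_sqrtZ|exact: distrB_sqrt].
Qed.
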